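(* Let $d$ and $k$ be fixed positive integers. Algorithm 1 (the dynamic program specified in the context), run on a vertex-weighted narrow $d$-dimensional Line of Sight network $G=(V,E,w)$ with parameters $n$, $k$ and $\omega$, given with its embedding, computes a maximum independent set of $G$ (an independent set of largest possible total weight) in time $$O\left(n\,\bigl(k^{(d-1)/\omega}\,\omega\bigr)^{k^{d-1}}\right).$$
   Context: **Networks.** For positive integers $d,k,n$, a narrow cube $\mathbb{Z}^d_{n,k}$ is $\{1,\dots,n\}\times\{1,\dots,x_1\}\times\cdots\times\{1,\dots,x_{d-1}\}$, where the $x_i$ are positive integers bounded by $k$, a constant independent of $n$. Two distinct points share a line of sight if their coordinates differ in a single place. A weighted graph $G=(V,E,w)$, with $w$ assigning a positive weight to each vertex, is a narrow $d$-dimensional Line of Sight (LoS) network with parameters $n,k$ and range parameter $\omega$ (a positive integer) if there is an embedding $f_G:V\to\mathbb{Z}^d_{n,k}$ such that $\{u,v\}\in E$ if and only if $f_G(u)$ and $f_G(v)$ share a line of sight and their Manhattan distance is less than $\omega$. **Arrays.** Arrays are $d$-dimensional tables of non-negative numbers with entries $A[\mathbf{i},j]$, where $\mathbf{i}=(i_1,\dots,i_{d-1})\in\{1,\dots,k\}^{d-1}$ is the row index and $j$ the column index. $A[j_1:j_2]$ is the sub-array of columns $j_1,\dots,j_2$, and $A[j]$ is column $j$. For arrays of the same size, $A_1\le_a A_2$ means $A_1[\mathbf{i},j]\le A_2[\mathbf{i},j]$ for all $\mathbf{i},j$. $A_1\vDash A_2$ (''$A_1$ is consistent with $A_2$'')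 means that $A_1$ without its first column equals $A_2$ without its last column. The network $G$ is identified with the array, also called $G$, with rows $\mathbf{i}\in\{1,\dots,k\}^{d-1}$ and columns $j\in\{-(\omega-1),\dots,n\}$, where $G[\mathbf{i},j]=w(v)$ if $(j,\mathbf{i})$ is the location of a vertex $v$, and $G[\mathbf{i},j]=0$ otherwise; in particular all columns $j\le 0$ are zero. **Feasible arrays.** $\mathcal{F}$ is the set of feasible arrays: the $0/1$ arrays $W$ with rows $\{1,\dots,k\}^{d-1}$ and $\omega$ columns whose non-zero entries are the non-zero entries of an independent array with $\omega$ columns. That is, two non-zero entries in the same row lie in columns at distance at least $\omega$, and two non-zero entries in the same column have row indices which either do not share a line of sight or do but differ by at least $\omega$ in the differing coordinate. For each $j$, $\mathcal{F}_{G,j}$ is the set of $W\in\mathcal{F}$ with $W\le_a G[j-\omega+1:j]$. **Algorithm 1.** 1. Initialisation: set $\mathrm{MIS}[0,\vec 0]=0$, where $\vec 0$ is the all-zero array with $\omega$ columns; set $\mathrm{MIS}[j,W]=0$ for all $j=1,\dots,n$ and $W\in\mathcal{F}$. 2. For $j=1,\dots,n$ and for each $W\in\mathcal{F}_{G,j}$: let $W^*\in\mathcal{F}_{G,j-1}$ with $W^*\vDash W$ maximize $\mathrm{MIS}[j-1,W^*]$; set $\mathrm{MIS}[j,W]=\langle W[\omega],G[j]\rangle+\mathrm{MIS}[j-1,W^*]$, where $\langle\cdot,\cdot\rangle$ is the Frobenius product (sum of products of corresponding entries) of the last column $W[\omega]$ of $W$ with column $j$ of $G$; set $\mathrm{pred}[j,W]=W^*$.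 3. Retrieval: find $W^*\in\mathcal{F}_{G,n}$ maximizing $\mathrm{MIS}[n,W^*]$ and let $I$ be the rightmost column of $W^*$. For $j=n$ down to $2$: replace $W^*$ by $\mathrm{pred}[j,W^*]$, then redefine $I$ as the rightmost column of this new $W^*$ concatenated with $I$. Return $I$; its non-zero entries mark the vertices of the computed independent set.
   Formalization: The set F_{G,j} compares W with the 0/1 array marking the vertices of G instead of with the weights in G[j-ω+1:j]; read literally, vertices of weight below 1 are discarded (a single vertex of weight 1/2 gives the empty set). For weights at least 1 both conditions agree. *)

(* Defs.v *)
From Stdlib Require Import String.
From HB Require Import structures.
From mathcomp Require Import all_boot all_order all_algebra.
From mathcomp Require Import reals exp.

Set Implicit Arguments.
Unset Strict Implicit.
Unset Printing Implicit Defensive.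

Import Order.TTheory GRing.Theory Num.Theory.

Section Networks.
Local Open Scope nat_scope.

Definition share_los (T : eqType) (l : nat) (p q : l.-tuple T) : bool :=
  #|[set a : 'I_l | tnth p a != tnth q a]| == 1.

Definition manhattan (l : nat) (p q : l.-tuple nat) : nat :=
  \sum_(a < l) `|tnth p a - tnth q a|.

(* The cube {1..n} x {1..x_1} x ... x {1..x_(d-1)}. *)
Definition in_cube (d n : nat) (x : d.-1.-tuple nat) (p : d.-tuple nat) : Prop :=
  forall a : 'I_d, 1 <= tnth p a <= nth 0 (n :: x) a.

Definition narrow_los_network (d k n omega : nat) (V : finType) (e : rel V)
    (f : V -> d.-tuple nat) : Prop :=
  [/\ injective f,
      exists x : d.-1.-tuple nat,
        (forall a, 1 <= tnth x a <= k) /\ (forall v, in_cube n x (f v))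
    & forall u v, e u v = share_los (f u) (f v) && (manhattan (f u) (f v) < omega)].

End Networks.

Section IndependentSets.
Local Open Scope ring_scope.
Variables (R : numDomainType) (V : finType) (e : rel V) (w : V -> R).

Definition independent (S : {set V}) : Prop :=
  forall u v, u \in S -> v \in S -> ~~ e u v.

Definition maximum_independent (S : {set V}) : Prop :=
  independent S /\
  forall T : {set V}, independent T -> \sum_(v in T) w v <= \sum_(v in S) w v.

End IndependentSets.

(* Row indices range over {1..k}^(d-1) and columns of an [arr] over {1..l};
   both are shifted by one here, so as to use ordinals. *)
Notation row_index d k := ((d.-1).-tuple 'I_k).
Notation arr R d k l := {ffun row_index d k * 'I_l -> R}.

Section Arrays.
Local Open Scope ring_scope.
Variables (R : numDomainType) (d k : nat).

Definition le_arr (l : nat) (A1 A2 : arr R d k l) : Prop :=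
  forall p, A1 p <= A2 p.

Definition consistent (l : nat) (A1 A2 : arr R d k l) : Prop :=
  forall i (c c' : 'I_l), c' = c.+1 :> nat -> A1 (i, c') = A2 (i, c).

Definition zero_arr (l : nat) : arr R d k l := [ffun=> 0].

Definition last_column (l : nat) (A : arr R d k l) (i : row_index d k) : R :=
  if insub l.-1 is Some c then A (i, c) else 0.

Definition support_arr (l : nat) (A : arr R d k l) : arr R d k l :=
  [ffun p => (A p != 0)%:R].

Definition location (j : int) (i : row_index d k) : seq int :=
  j :: [seq (val x).+1%:Z | x <- i].

Definition network_array (V : finType) (w : V -> R) (f : V -> d.-tuple nat)
    (i : row_index d k) (j : int) : R :=
  if [pick v | [seq x%:Z | x <- f v] == location j i] is Some v then w v else 0.

(* The columns j - omega + 1, ..., j of G. *)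
Definition window (omega : nat) (G : row_index d k -> int -> R) (j : nat) :
    arr R d k omega :=
  [ffun p : row_index d k * 'I_omega => G p.1 (j%:Z - omega%:Z + 1 + p.2%:Z)].

Definition marks (n : nat) (V : finType) (f : V -> d.-tuple nat)
    (I : arr R d k n) (S : {set V}) : Prop :=
  forall i (c : 'I_n), I (i, c) != 0 <->
    exists2 v, v \in S & [seq x%:Z | x <- f v] = location (c.+1)%:Z i.

Definition feasible (omega : nat) (W : arr R d k omega) : Prop :=
  [/\ forall p, W p = 0 \/ W p = 1,
      forall i (c c' : 'I_omega), c != c' ->
        W (i, c) != 0 -> W (i, c') != 0 -> (omega <= `|c - c'|)%N
    & forall (i i' : row_index d k) c, i != i' ->
        W (i, c) != 0 -> W (i', c) != 0 ->
        ~~ share_los i i' \/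
        forall a, tnth i a != tnth i' a -> (omega <= `|tnth i a - tnth i' a|)%N].

(* The 0/1 array W is compared with the 0/1 array marking the vertices of G
   rather than with the weights, so that vertices of weight below 1 are not
   lost; [le_support_arr] shows that nothing changes when all weights are at
   least 1. *)
Definition feasible_in (omega : nat) (G : row_index d k -> int -> R) (j : nat)
    (W : arr R d k omega) : Prop :=
  feasible W /\ le_arr W (support_arr (window omega G j)).

Lemma le_support_arr (l : nat) (W A : arr R d k l) :
    (forall p, W p = 0 \/ W p = 1) -> (forall p, A p = 0 \/ 1 <= A p) ->
  le_arr W (support_arr A) <-> le_arr W A.
Proof.
move=> W01 A01; split=> le p; move: (le p); rewrite !ffunE.
  case: (A01 p) => [->|A1]; first by rewrite eqxx.
  by case: (A p != 0) => // /le_trans; apply=> //; exact: le_trans ler01 A1.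
case: (A01 p) => [->|A1 _]; first by rewrite eqxx.
have -> : A p != 0 by apply: lt0r_neq0; exact: lt_le_trans ltr01 A1.
by case: (W01 p) => ->; rewrite ?ler01.
Qed.

End Arrays.

(* [dp_run] below relates a network to the tables and the output of a run of the
   dynamic program.  Ties between maximizers are broken arbitrarily. *)

Section Algorithm.
Local Open Scope ring_scope.
Variables (R : numDomainType) (d k n omega : nat).
Variable G : row_index d k -> int -> R.
Implicit Types (MIS : nat -> arr R d k omega -> R).
Implicit Types (pred : nat -> arr R d k omega -> arr R d k omega).

Definition initialisation MIS : Prop :=
  MIS 0 (zero_arr R d k omega) = 0 /\
  forall j W, (1 <= j <= n)%N -> feasible W -> ~ feasible_in G j W -> MIS j W = 0.

Definition recurrence MIS pred : Prop :=
  forall j W, (1 <= j <= n)%N -> feasible_in G j W ->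
    let W' := pred j W in
    [/\ feasible_in G j.-1 W',
        consistent W' W,
        forall W'', feasible_in G j.-1 W'' -> consistent W'' W ->
          MIS j.-1 W'' <= MIS j.-1 W'
      & MIS j W = \sum_i last_column W i * G i j%:Z + MIS j.-1 W'].

(* [Ws j] is the value of W^* from which column j of the output is read. *)
Definition retrieval MIS pred (I : arr R d k n) : Prop :=
  exists Ws : nat -> arr R d k omega,
    [/\ feasible_in G n (Ws n),
        forall W, feasible_in G n W -> MIS n W <= MIS n (Ws n),
        forall j, (2 <= j <= n)%N -> Ws j.-1 = pred j (Ws j)
      & forall i (c : 'I_n), I (i, c) = last_column (Ws c.+1) i].

Definition dp_run MIS pred (I : arr R d k n) : Prop :=
  [/\ initialisation MIS, recurrence MIS pred & retrieval MIS pred I].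

End Algorithm.

(* A random access machine with unit costs.  The memory consists of arrays of
   natural numbers and arrays of weights; a scalar variable is cell 0 of an
   array.  Every node of an evaluated expression, every assignment, every test
   and every loop iteration takes one unit of time.  There is no bound on the
   size of a natural number, but those arising in [dp_program] are polynomial
   in n and omega for fixed d and k. *)

Inductive nop := Nadd | Nsub | Nmul | Ndiv | Nmod.

Inductive nexp :=
  | Nlit of nat
  | Nget of string & nexp
  | Nbin of nop & nexp & nexp.

Inductive rexp :=
  | Rzero
  | Rget of string & nexp
  | Radd of rexp & rexp.

Inductive bexp :=
  | Beq of nexp & nexp
  | Blt of nexp & nexp
  | Brlt of rexp & rexp
  | Band of bexp & bexp
  | Bnot of bexp.

Inductive stmt :=
  | Skip
  | Nset of string & nexp & nexp
  | Rset of string & nexp & rexp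
  | Seq of stmt & stmt
  | If of bexp & stmt & stmt
  | For of string & nexp & stmt.

Fixpoint ncost (e : nexp) : nat :=
  match e with
  | Nlit _ => 1
  | Nget _ i => (ncost i).+1
  | Nbin _ e1 e2 => (ncost e1 + ncost e2).+1
  end.

Fixpoint rcost (e : rexp) : nat :=
  match e with
  | Rzero => 1
  | Rget _ i => (ncost i).+1
  | Radd e1 e2 => (rcost e1 + rcost e2).+1
  end.

Fixpoint bcost (b : bexp) : nat :=
  match b with
  | Beq e1 e2 | Blt e1 e2 => (ncost e1 + ncost e2).+1
  | Brlt e1 e2 => (rcost e1 + rcost e2).+1
  | Band b1 b2 => (bcost b1 + bcost b2).+1
  | Bnot b1 => (bcost b1).+1
  end.

Definition update (T : Type) (m : string -> nat -> T) (x : string) (i : nat) (v : T) :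
    string -> nat -> T :=
  fun y j => if String.eqb y x && (j == i) then v else m y j.

Section Semantics.
Variable R : numDomainType.

Record state := State {
  nmem : string -> nat -> nat;
  rmem : string -> nat -> R
}.

Implicit Type s : state.

Definition nop_fun (o : nop) : nat -> nat -> nat :=
  match o with
  | Nadd => addn | Nsub => subn | Nmul => muln | Ndiv => divn | Nmod => modn
  end.

Fixpoint neval s (e : nexp) : nat :=
  match e with
  | Nlit a => a
  | Nget x i => nmem s x (neval s i)
  | Nbin o e1 e2 => nop_fun o (neval s e1) (neval s e2)
  end.

Fixpoint reval s (e : rexp) : R :=
  match e with
  | Rzero => 0%R
  | Rget x i => rmem s x (neval s i)
  | Radd e1 e2 => (reval s e1 + reval s e2)%R
  end.

Fixpoint beval s (b : bexp) : bool :=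
  match b with
  | Beq e1 e2 => neval s e1 == neval s e2
  | Blt e1 e2 => neval s e1 < neval s e2
  | Brlt e1 e2 => (reval s e1 < reval s e2)%R
  | Band b1 b2 => beval s b1 && beval s b2
  | Bnot b1 => ~~ beval s b1
  end.

Definition nset s x i v : state := State (update (nmem s) x i v) (rmem s).
Definition rset s x i v : state := State (nmem s) (update (rmem s) x i v).

(* [For x e c] runs c with x = 0, 1, ..., e - 1; the bound e is evaluated once. *)
Fixpoint exec (c : stmt) s : state * nat :=
  match c with
  | Skip => (s, 0)
  | Nset x i e => (nset s x (neval s i) (neval s e), (ncost i + ncost e).+1)
  | Rset x i e => (rset s x (neval s i) (reval s e), (ncost i + rcost e).+1)
  | Seq c1 c2 =>
      let: (s1, t1) := exec c1 s in
      let: (s2, t2) := exec c2 s1 in (s2, t1 + t2)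
  | If b c1 c2 =>
      let: (s1, t1) := if beval s b then exec c1 s else exec c2 s in
      (s1, (bcost b + t1).+1)
  | For x e c1 =>
      iteri (neval s e)
        (fun i st => let: (s1, t1) := exec c1 (nset st.1 x 0 i) in
                     (s1, (st.2 + t1).+1))
        (s, (ncost e).+1)
  end.

End Semantics.

(* The dynamic program, written for this machine.  A feasible array has at most
   one non-zero entry in each row.  It is encoded by the number whose digit in
   base omega + 1 at the place of a row is 0 if the row is zero and c if its
   non-zero entry is in column c of {1..omega}.  Rows are numbered by reading
   their index in base k.  Column j of G is stored at position j + omega - 1, as
   G starts with column -(omega - 1). *)

Declare Scope nexp_scope.
Declare Scope rexp_scope.
Declare Scope bexp_scope.
Declare Scope stmt_scope.
Delimit Scope nexp_scope with nexp.
Delimit Scope rexp_scope with rexp.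
Delimit Scope bexp_scope with bexp.
Delimit Scope stmt_scope with stmt.
Bind Scope nexp_scope with nexp.
Bind Scope rexp_scope with rexp.
Bind Scope bexp_scope with bexp.
Bind Scope stmt_scope with stmt.
Arguments Nget _ _%_nexp.
Arguments Nbin _ _%_nexp _%_nexp.
Arguments Rget _ _%_nexp.
Arguments Radd _%_rexp _%_rexp.
Arguments Beq _%_nexp _%_nexp.
Arguments Blt _%_nexp _%_nexp.
Arguments Brlt _%_rexp _%_rexp.
Arguments Band _%_bexp _%_bexp.
Arguments Bnot _%_bexp.
Arguments Nset _ _%_nexp _%_nexp.
Arguments Rset _ _%_nexp _%_rexp.
Arguments Seq _%_stmt _%_stmt.
Arguments If _%_bexp _%_stmt _%_stmt.
Arguments For _ _%_nexp _%_stmt.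

Definition Nvar (x : string) : nexp := Nget x (Nlit 0).

Module ProgramNotations.
Coercion Nlit : nat >-> nexp.
Coercion Nvar : string >-> nexp.
Notation "x .[ i ]" := (Nget x i) : nexp_scope.
Notation "e1 + e2" := (Nbin Nadd e1 e2) : nexp_scope.
Notation "e1 - e2" := (Nbin Nsub e1 e2) : nexp_scope.
Notation "e1 * e2" := (Nbin Nmul e1 e2) : nexp_scope.
Notation "e1 %/ e2" := (Nbin Ndiv e1 e2) : nexp_scope.
Notation "e1 %% e2" := (Nbin Nmod e1 e2) : nexp_scope.
Notation "x .[ i ]" := (Rget x i) : rexp_scope.
Notation "e1 + e2" := (Radd e1 e2) : rexp_scope.
Notation "e1 == e2" := (Beq e1 e2) : bexp_scope.
Notation "e1 < e2" := (Blt e1 e2) : bexp_scope.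
Notation "b1 && b2" := (Band b1 b2) : bexp_scope.
Notation "~~ b" := (Bnot b) : bexp_scope.
Notation "x ::= e" := (Nset x (Nlit 0) e)
  (at level 80, no associativity) : stmt_scope.
Notation "c1 ;; c2" := (Seq c1 c2) (at level 90, right associativity) : stmt_scope.
End ProgramNotations.

Section Program.
Import ProgramNotations.
Local Open Scope string_scope.
Local Open Scope nat_scope.
Local Open Scope stmt_scope.

Definition digit (c r : nexp) : nexp := ((c %/ "pow".[r]) %% "base")%nexp.

(* rows = k^(d-1), base = omega + 1, pow[r] = base^r,
   codes = base^rows, masks = 2^rows *)
Definition setup : stmt :=
  "rows" ::= 1;;
  For "a" ("d" - 1) ("rows" ::= "rows" * "k");;
  "base" ::= "omega" + 1;;
  "codes" ::= 1;;
  "masks" ::= 1;;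
  For "r" "rows" (
    Nset "pow" "r" "codes";;
    "codes" ::= "codes" * "base";;
    "masks" ::= "masks" * 2).

(* feas[c] = 1 iff the array with code c is feasible *)
Definition compute_feasible : stmt :=
  For "c" "codes" (
    Nset "feas" "c" 1;;
    For "r" "rows" (For "s" "rows" (
      If ((0 < digit "c" "r") && (digit "c" "r" == digit "c" "s")) (
        "differ" ::= 0;;
        "dist" ::= 0;;
        "place" ::= 1;;
        For "a" ("d" - 1) (
          "x" ::= ("r" %/ "place") %% "k";;
          "y" ::= ("s" %/ "place") %% "k";;
          If (~~ ("x" == "y")) (
            "differ" ::= "differ" + 1;;
            "dist" ::= ("x" - "y") + ("y" - "x"))
            Skip;;
          "place" ::= "place" * "k");;
        If (("differ" == 1) && ("dist" < "omega")) (Nset "feas" "c" 0) Skip)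
        Skip))).

(* res := 1 if the array with code c satisfies [feasible_in G j], and 0
   otherwise.  Its entry of row r lies in column j - omega + digit of G. *)
Definition test_feasible_in (res : string) (c j : nexp) : stmt :=
  res ::= "feas".[c];;
  For "r" "rows" (
    If ((0 < digit c "r") &&
        ~~ Brlt Rzero ("G".[(j + digit c "r" - 1) * "rows" + "r"]))
      (res ::= 0) Skip).

(* If cand has a larger value than best in column j of MIS, or no best has been
   found yet, then best := cand. *)
Definition improve (cand j : nexp) : stmt :=
  If ("found" == 0) ("best" ::= cand;; "found" ::= 1)
    (If (Brlt ("MIS".[j * "codes" + "best"]) ("MIS".[j * "codes" + cand]))
      ("best" ::= cand) Skip).

Definition initialise : stmt :=
  Rset "MIS" 0 Rzero;;
  For "t" "n" (For "c" "codes" (Rset "MIS" (("t" + 1) * "codes" + "c") Rzero)).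

(* The array with code cand agrees with the one with code c shifted by one
   column, and its first column is, in the remaining rows, given by the bits of
   mask. *)
Definition predecessor_candidate : stmt :=
  "cand" ::= 0;;
  "bits" ::= "mask";;
  For "r" "rows" (
    If ((0 < digit "c" "r") && (digit "c" "r" < "omega"))
      ("cand" ::= "cand" + (digit "c" "r" + 1) * "pow".["r"])
      ("cand" ::= "cand" + ("bits" %% 2) * "pow".["r"]);;
    "bits" ::= "bits" %/ 2).

(* As the last column of W is a 0/1 column, its Frobenius product with a column
   of G is accumulated by adding the entries of G selected by W. *)
Definition fill_tables : stmt :=
  For "t" "n" (
    "j" ::= "t" + 1;;
    For "c" "codes" (
      test_feasible_in "ok" "c" "j";;
      If ("ok" == 1) (
        "found" ::= 0;;
        For "mask" "masks" (
          predecessor_candidate;;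
          test_feasible_in "okcand" "cand" ("j" - 1);;
          If ("okcand" == 1) (improve "cand" ("j" - 1)) Skip);;
        Rset "product" 0 Rzero;;
        For "r" "rows" (
          If (digit "c" "r" == "omega")
            (Rset "product" 0
              ("product".[0] + "G".[("j" + "omega" - 1) * "rows" + "r"]))
            Skip);;
        Rset "MIS" ("j" * "codes" + "c")
          ("product".[0] + "MIS".[("j" - 1) * "codes" + "best"]);;
        Nset "pred" ("j" * "codes" + "c") "best")
        Skip)).

(* Writes the last column of the array with code best in column j of I *)
Definition write_column (j : nexp) : stmt :=
  For "r" "rows" (
    If (digit "best" "r" == "omega")
      (Nset "I" ((j - 1) * "rows" + "r") 1)
      (Nset "I" ((j - 1) * "rows" + "r") 0)).

Definition retrieve : stmt :=
  "found" ::= 0;;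
  For "c" "codes" (
    test_feasible_in "ok" "c" "n";;
    If ("ok" == 1) (improve "c" "n") Skip);;
  write_column "n";;
  For "t" ("n" - 1) (
    "j" ::= "n" - "t";;
    "best" ::= "pred".["j" * "codes" + "best"];;
    write_column ("j" - 1)).

Definition dp_program : stmt :=
  setup;; compute_feasible;; initialise;; fill_tables;; retrieve.

End Program.

Section Memory.
Local Open Scope ring_scope.
Variables (R : numDomainType) (d k n omega : nat).

Definition row_rank (i : row_index d k) : nat :=
  (\sum_(a < d.-1) tnth i a * k ^ a)%N.

Definition code (W : arr R d k omega) : nat :=
  (\sum_i (\sum_(c < omega | W (i, c) != 0%R) c.+1) * omega.+1 ^ row_rank i)%N.

Definition decode (a : nat) : arr R d k omega :=
  [ffun p : row_index d k * 'I_omega =>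
     (a %/ omega.+1 ^ row_rank p.1 %% omega.+1 == p.2.+1)%N%:R].

Definition stores_network (G : row_index d k -> int -> R) (s : state R) : Prop :=
  [/\ nmem s "d" 0 = d, nmem s "k" 0 = k, nmem s "n" 0 = n, nmem s "omega" 0 = omega
    & forall i (c : nat), (c < n + omega)%N ->
        rmem s "G" (c * k ^ d.-1 + row_rank i) = G i (c%:Z - (omega%:Z - 1))].

Definition table_index (j : nat) (W : arr R d k omega) : nat :=
  (j * (omega.+1 ^ (k ^ d.-1)) + code W)%N.

Definition stored_MIS (s : state R) (j : nat) (W : arr R d k omega) : R :=
  rmem s "MIS" (table_index j W).

Definition stored_pred (s : state R) (j : nat) (W : arr R d k omega) : arr R d k omega :=
  decode (nmem s "pred" (table_index j W)).

Definition stored_output (s : state R) : arr R d k n :=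
  [ffun p : row_index d k * 'I_n => (nmem s "I" (p.2 * k ^ d.-1 + row_rank p.1))%:R].

End Memory.

(* Main.v *)
(* An edge joins two vertices less than omega columns apart.  Hence a set of
   vertices is independent if and only if its restrictions to omega consecutive
   columns are, and independent sets correspond to chains of consistent feasible
   windows that start with the zero window at column 0.  The weight of the set is
   the sum over j of the products of the last column of window j with column j of
   the network.  By induction on j, the recurrence computes the largest weight of
   a chain that ends in a given window, and following pred recovers a chain.

   A feasible window has at most one non-zero entry in each of its k^(d-1) rows,
   so that at most (omega + 1)^(k^(d-1)) <= (2 omega)^(k^(d-1)) of them occur for
   each of the n columns.  Shifting a window leaves only the new first column to
   be chosen, which gives at most 2^(k^(d-1)) predecessors.  The bound follows, as
   k^((d-1)/omega) >= 1.

   That the machine program runs this recurrence is shown by loop invariants,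
   where every array that a command does not write is framed. *)
Require Import Defs.
From Stdlib Require Import String.
From mathcomp Require Import all_boot all_order all_algebra.
From mathcomp Require Import reals exp.
From mathcomp Require Import zify.

Set Implicit Arguments.
Unset Strict Implicit.
Unset Printing Implicit Defensive.

Import Order.TTheory GRing.Theory Num.Theory.

(** * Runs of machine programs *)

(** Optimality is proved for the relation [dp_run] with arbitrary ties, and the machine is only
    shown to satisfy [dp_run]; the two halves share nothing else. Between memory and arrays stands a
    level on which an array is its code and the network a function [g] of a stored column and a row
    number, so that the loop invariants speak of numbers only.

    Windows suffice because an edge that leaves its column stays in its row. A selected entry moves
    unchanged through consistent windows and drops out after [omega] columns, so both ends of an
    edge are visible in the window that ends at the right one.

    The running time does not come from the invariants. It is bounded on the syntax: both branches
    of a test are charged, and loop bounds are evaluated once, which is sound because the phases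
    after [setup] never write a name that bounds a loop. Only [n] and the number of codes grow; the
    numbers of rows, of coordinates and of masks depend on [d] and [k] alone and go into the
    constant. *)

Fixpoint nreads (e : nexp) : seq string :=
  match e with
  | Nlit _ => [::]
  | Nget x i => x :: nreads i
  | Nbin _ e1 e2 => nreads e1 ++ nreads e2
  end.

Fixpoint writes (c : stmt) : seq string :=
  match c with
  | Skip => [::]
  | Nset x _ _ | Rset x _ _ => [:: x]
  | Seq c1 c2 | If _ c1 c2 => writes c1 ++ writes c2
  | For x _ c1 => x :: writes c1
  end.

Fixpoint bound_reads (c : stmt) : seq string :=
  match c with
  | Skip | Nset _ _ _ | Rset _ _ _ => [::]
  | Seq c1 c2 | If _ c1 c2 => bound_reads c1 ++ bound_reads c2
  | For _ e c1 => nreads e ++ bound_reads c1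
  end.

(** A boolean test by [String.eqb], so that side conditions about concrete names are closed by
    computation. *)
Definition named (X : seq string) (x : string) : bool := has (String.eqb x) X.

Lemma named_cat X Y x : named (X ++ Y) x = named X x || named Y x.
Proof. exact: has_cat. Qed.

Lemma eqb_refl_string x : String.eqb x x.
Proof. exact/String.eqb_eq. Qed.

Lemma named_all X Y x : all (named X) Y -> named Y x -> named X x.
Proof.
elim: Y => //= y Y IH /andP[yX YX] /orP[/String.eqb_eq ->//|]; exact: IH.
Qed.

Section Machine.
Variable R : numDomainType.
Implicit Types (s : state R) (c : stmt) (X : seq string).

Definition run c s : state R := (exec c s).1.
Definition time c s : nat := (exec c s).2.
Arguments run : simpl never.
Arguments time : simpl never.

Lemma run_seq c1 c2 s : run (Seq c1 c2) s = run c2 (run c1 s).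
Proof.
by rewrite /run /=; case: (exec c1 s) => s1 t1 /=; case: (exec c2 s1).
Qed.

Lemma run_if b c1 c2 s :
  run (If b c1 c2) s = if beval s b then run c1 s else run c2 s.
Proof. by rewrite /run /=; case: (beval s b); case: (exec _ s). Qed.

Lemma run_for_iteri x e c s :
  run (For x e c) s = iteri (neval s e) (fun i s' => run c (nset s' x 0 i)) s.
Proof.
rewrite /run /=; elim: (neval s e) => //= m <-.
by case: (iteri _ _ _) => s1 t1 /=; case: (exec c _).
Qed.

Lemma time_seq c1 c2 s : time (Seq c1 c2) s = time c1 s + time c2 (run c1 s).
Proof.
by rewrite /time /run /=; case: (exec c1 s) => s1 t1 /=; case: (exec c2 s1).
Qed.

Lemma time_if b c1 c2 s :
  time (If b c1 c2) s = (bcost b + if beval s b then time c1 s else time c2 s).+1.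
Proof. by rewrite /time /=; case: (beval s b); case: (exec _ s). Qed.

Definition agree X s s' : Prop :=
  (forall x i, ~~ named X x -> nmem s' x i = nmem s x i) /\
  (forall x i, ~~ named X x -> rmem s' x i = rmem s x i).

Lemma agree_refl X s : agree X s s. Proof. by []. Qed.

Lemma agree_trans X s1 s2 s3 : agree X s1 s2 -> agree X s2 s3 -> agree X s1 s3.
Proof.
by case=> N1 R1 [N2 R2]; split=> x i xX; rewrite ?N2 ?N1 ?R2 ?R1.
Qed.

Lemma agree_sub X Y s s' :
  (forall x, named X x -> named Y x) -> agree X s s' -> agree Y s s'.
Proof. by move=> XY [N1 R1]; split=> x i /(contra (XY x)); [exact: N1|exact: R1]. Qed.

Lemma agree_nset X s x i v : named X x -> agree X s (nset s x i v).
Proof.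
move=> xX; split=> // y j yX /=; rewrite /update.
by case E: (String.eqb y x) => //; move/String.eqb_eq: E yX => ->; rewrite xX.
Qed.

Lemma agree_rset X s x i v : named X x -> agree X s (rset s x i v).
Proof.
move=> xX; split=> // y j yX /=; rewrite /update.
by case E: (String.eqb y x) => //; move/String.eqb_eq: E yX => ->; rewrite xX.
Qed.

Lemma agree_index X x s s' i v :
  agree (x :: X) s s' -> agree (x :: X) s (nset s' x i v).
Proof.
by move/agree_trans; apply; apply: agree_nset; rewrite /= eqb_refl_string.
Qed.

Lemma agree_iteri X (F : nat -> state R -> state R) m s :
  (forall i s', agree X s' (F i s')) -> agree X s (iteri m F s).
Proof.
by move=> XF; elim: m => [|m IH] //=; exact: agree_trans IH (XF _ _).
Qed.

Lemma run_agree c s : agree (writes c) s (run c s).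
Proof.
elim: c s => [|x i e|x i e|c1 IH1 c2 IH2|b c1 IH1 c2 IH2|x e c IH] s //=.
- by apply: agree_nset; rewrite /= eqb_refl_string.
- by apply: agree_rset; rewrite /= eqb_refl_string.
- rewrite run_seq; apply: agree_trans.
    by apply: agree_sub (IH1 s) => y; rewrite named_cat => ->.
  by apply: agree_sub (IH2 _) => y; rewrite named_cat orbC => ->.
- rewrite run_if; case: ifP => _.
    by apply: agree_sub (IH1 s) => y; rewrite named_cat => ->.
  by apply: agree_sub (IH2 _) => y; rewrite named_cat orbC => ->.
- rewrite run_for_iteri; apply: agree_iteri => i s'.
  apply: (@agree_trans _ _ (nset s' x 0 i)).
    by apply: agree_nset; rewrite /= eqb_refl_string.
  by apply: agree_sub (IH _) => y; rewrite /= => ->; rewrite orbT.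
Qed.

Lemma run_nmem c s x i : ~~ named (writes c) x -> nmem (run c s) x i = nmem s x i.
Proof. by case: (run_agree c s) => + _; apply. Qed.

(** The step may use agreement with the state before the loop, which frees [Inv] from listing what
    the loop leaves alone. The index is set between the invariant and the body, hence [x] counts as
    written. *)
Lemma run_for (Inv : nat -> state R -> Prop) m x e c s :
    neval s e = m -> Inv 0 s ->
    (forall i s', i < m -> agree (x :: writes c) s s' -> Inv i s' ->
       Inv i.+1 (run c (nset s' x 0 i))) ->
  Inv m (run (For x e c) s).
Proof.
move=> <- Inv0 InvS {m}; rewrite run_for_iteri.
set F := fun i s' => _.
suff: forall m, m <= neval s e ->
    agree (x :: writes c) s (iteri m F s) /\ Inv m (iteri m F s).
  by move/(_ _ (leqnn _)) => [].
elim=> [|m IH] lt_m //=; have [agm Invm] := IH (ltnW lt_m); split; last exact: InvS.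
apply: agree_trans agm _; rewrite /F; apply: (@agree_trans _ _ (nset (iteri m F s) x 0 m)).
  by apply: agree_nset; rewrite /= eqb_refl_string.
by apply: agree_sub (run_agree _ _) => y; rewrite /= => ->; rewrite orbT.
Qed.

Lemma neval_agree X s s' e :
  all (fun x => ~~ named X x) (nreads e) -> agree X s s' -> neval s' e = neval s e.
Proof.
move=> eX [ag _]; elim: e eX => [//|x i IH|o e1 IH1 e2 IH2] /=.
  by case/andP=> xX iX; rewrite IH // ag.
by rewrite all_cat => /andP[X1 X2]; rewrite IH1 // IH2.
Qed.

(* The loop bounds are all evaluated in s0: [time_le] applies when the loops of
   c do not change them. *)
Fixpoint time_bound s0 c : nat :=
  match c with
  | Skip => 0
  | Nset _ i e => (ncost i + ncost e).+1
  | Rset _ i e => (ncost i + rcost e).+1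
  | Seq c1 c2 => time_bound s0 c1 + time_bound s0 c2
  | If b c1 c2 => (bcost b + (time_bound s0 c1 + time_bound s0 c2)).+1
  | For _ e c1 => (ncost e).+1 + neval s0 e * (time_bound s0 c1).+1
  end.

Lemma time_le X s0 c s :
    all (fun x => ~~ named X x) (bound_reads c) -> all (named X) (writes c) ->
  agree X s0 s -> time c s <= time_bound s0 c.
Proof.
have sub_run c' s' : all (named X) (writes c') -> agree X s' (run c' s').
  by move=> wX; apply: agree_sub (run_agree c' s') => y; exact: named_all.
elim: c s => [|x i e|x i e|c1 IH1 c2 IH2|b c1 IH1 c2 IH2|x e c IH] s //=.
- rewrite !all_cat => /andP[b1 b2] /andP[w1 w2] ag.
  rewrite time_seq leq_add ?IH1 ?IH2 //.
  by apply: agree_trans ag _; exact: sub_run.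
- rewrite !all_cat => /andP[b1 b2] /andP[w1 w2] ag.
  rewrite time_if ltnS leq_add2l.
  by case: ifP => _; [apply: leq_trans (IH1 _ _ _ _) _|apply: leq_trans (IH2 _ _ _ _) _];
    rewrite ?leq_addr ?leq_addl.
- rewrite all_cat => /andP[be bc] /andP[xX wc] ag.
  rewrite /time /= -(neval_agree be ag).
  set F := fun i st => _.
  suff: forall m, agree X s0 (iteri m F (s, (ncost e).+1)).1 /\
      (iteri m F (s, (ncost e).+1)).2 <= (ncost e).+1 + m * (time_bound s0 c).+1.
    by case/(_ (neval s e)).
  elim=> [|m [agm tm]] /=; first by rewrite mul0n addn0.
  have agm' : agree X s0 (nset (iteri m F (s, (ncost e).+1)).1 x 0 m).
    by apply: agree_trans agm _; exact: agree_nset.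
  have := IH _ bc wc agm'; have := agree_trans agm' (sub_run _ _ wc).
  rewrite /F /run /time -/F; case: (exec c _) => s1 t1 /= ag1 tt1; split=> //; nia.
Qed.

End Machine.

Arguments run : simpl never.
Arguments time : simpl never.

(** * Digits *)

Section Digits.
Variables (B : nat) (B_gt0 : 0 < B).

Lemma digits_lt (f : nat -> nat) N :
  (forall r, r < N -> f r < B) -> \sum_(r < N) f r * B ^ r < B ^ N.
Proof.
elim: N => [|N IH] fB; first by rewrite big_ord0.
rewrite big_ord_recr /= expnS.
have ltS := IH (fun r rN => fB r (ltnW rN)).
by apply: leq_trans (leq_mul (fB N (ltnSn N)) (leqnn _)); rewrite mulSn ltn_add2r.
Qed.

Lemma digits_nth (f : nat -> nat) N r :
    (forall r, r < N -> f r < B) -> r < N ->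
  (\sum_(r < N) f r * B ^ r) %/ B ^ r %% B = f r.
Proof.
elim: N => [//|N IH] fB; have fB' r' (rN : r' < N) := fB r' (ltnW rN).
rewrite big_ord_recr /= ltnS leq_eqVlt => /orP[/eqP->|lt_rN].
  rewrite divnDMl ?expn_gt0 ?B_gt0 // divn_small ?digits_lt //.
  by rewrite add0n modn_small ?fB.
(* After division by [B ^ r] the leading term is still a multiple of [B], so it vanishes modulo
   [B]. *)
have -> : B ^ N = B ^ (N - r.+1) * B * B ^ r by rewrite -(expnSr B) -expnD addSnnS subnK.
by rewrite mulnA divnDMl ?expn_gt0 ?B_gt0 // mulnA addnC modnMDl IH.
Qed.

Lemma sum_digits N c : \sum_(r < N) (c %/ B ^ r %% B) * B ^ r = c %% B ^ N.
Proof.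
elim: N => [|N IH]; first by rewrite big_ord0 modn1.
rewrite big_ord_recr /= IH.
(* Without its multiple of [B ^ N.+1], [c] consists of its [N] lower digits and digit [N]. *)
have cE : c = c %/ B ^ N %/ B * B ^ N.+1 + (c %% B ^ N + c %/ B ^ N %% B * B ^ N).
  by rewrite expnS mulnA (addnC (c %% _)) addnA -mulnDl -!divn_eq.
rewrite [in RHS]cE modnMDl [RHS]modn_small // expnS.
have ltE : c %% B ^ N < B ^ N by rewrite ltn_mod expn_gt0 B_gt0.
have ltB : c %/ B ^ N %% B < B by rewrite ltn_mod.
by apply: leq_trans (leq_mul ltB (leqnn _)); rewrite mulSn ltn_add2r.
Qed.

End Digits.

Lemma all_iotaS (P : pred nat) i : all P (iota 0 i.+1) = all P (iota 0 i) && P i.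
Proof. by rewrite -addn1 iotaD all_cat /= andbT. Qed.

(** * The dynamic program on codes of arrays *)

Section Specification.
Import ProgramNotations.
Local Open Scope string_scope.
Local Open Scope nat_scope.
Variables (R : realDomainType) (d k n omega : nat).
Hypotheses (k_gt0 : 0 < k) (n_gt0 : 0 < n) (omega_gt0 : 0 < omega).
(** Weight at a stored column and a row number; stored column [c] is column [c - (omega - 1)] of the
    network. Keeping it abstract separates the loop invariants from tuples and embeddings. *)
Variable g : nat -> nat -> R.
Implicit Types s : state R.

Local Notation N := (k ^ d.-1).
Local Notation B := omega.+1.
Local Notation A := (B ^ N).

Definition digit_at (c r : nat) : nat := c %/ B ^ r %% B.

Record inputs (s : state R) : Prop := Inputs {
  in_d : nmem s "d" 0 = d;
  in_k : nmem s "k" 0 = k;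
  in_n : nmem s "n" 0 = n;
  in_omega : nmem s "omega" 0 = omega;
  in_G : forall c r, c < n + omega -> r < N -> rmem s "G" (c * N + r) = g c r
}.

(** What [setup] establishes. All later phases preserve it, since none of them writes a name in
    [env_names]. *)
Record env (s : state R) : Prop := Env {
  env_inputs :> inputs s;
  env_rows : nmem s "rows" 0 = N;
  env_base : nmem s "base" 0 = B;
  env_codes : nmem s "codes" 0 = A;
  env_masks : nmem s "masks" 0 = 2 ^ N;
  env_pow : forall r, r < N -> nmem s "pow" r = B ^ r
}.

Definition env_names : seq string :=
  [:: "d"; "k"; "n"; "omega"; "rows"; "base"; "codes"; "masks"; "pow"; "G"]%string.

Lemma inputs_agree X s s' :
    all (fun x => ~~ named X x) [:: "d"; "k"; "n"; "omega"; "G"]%string ->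
  agree X s s' -> inputs s -> inputs s'.
Proof.
rewrite /= => /and5P[d0 k0 n0 o0 /andP[G0 _]] [Nag Rag] [dE kE nE oE GE].
by split=> *; rewrite ?Nag ?Rag ?GE.
Qed.

Lemma env_agree X s s' :
  all (fun x => ~~ named X x) env_names -> agree X s s' -> env s -> env s'.
Proof.
move=> /= /and5P[d0 k0 n0 o0 /and5P[r0 b0 c0 m0 /and3P[p0 G0 _]]] ag [iE rE bE cE mE pE].
have := ag; case=> Nag Rag; split=> *; rewrite ?Nag ?pE //.
by apply: inputs_agree ag iE; rewrite /= d0 k0 n0 o0 G0.
Qed.

Lemma digitE s c r v w : env s -> neval s c = v -> neval s r = w -> w < N ->
  neval s (digit c r) = digit_at v w.
Proof. by move=> sE /= -> -> wN; rewrite (env_pow sE) // (env_base sE). Qed.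

Lemma run_nset s x i e : run (Nset x i e) s = nset s x (neval s i) (neval s e).
Proof. by []. Qed.

Lemma run_rset s x i e : run (Rset x i e) s = rset s x (neval s i) (reval s e).
Proof. by []. Qed.

Definition runE := (run_seq, run_if, run_nset, run_rset).

Lemma setup_env s : inputs s -> env (run setup s).
Proof.
move=> sI; rewrite /setup !run_seq.
set s1 := run (Nset "rows" _ _) s.
have sI1 : inputs s1 by apply: inputs_agree (run_agree _ _) sI.
have rows1 : nmem s1 "rows" 0 = 1 by [].
move: s1 sI1 rows1 => s1 sI1 rows1.
set L1 := For "a" _ _; set L2 := For "r" _ _.
have rowsE : nmem (run L1 s1) "rows" 0 = N.
  apply: (@run_for R (fun i s' => nmem s' "rows" 0 = k ^ i)).
  - by rewrite /= (in_d sI1) subn1.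
  - by [].
  move=> i s' _ [ag _] IH.
  by rewrite /= /update /= IH ag //= (in_k sI1) expnSr.
have sI2 : inputs (run L1 s1).
  by exact: inputs_agree (run_agree _ _) sI1.
move: (run L1 s1) rowsE sI2 => s2 rowsE sI2 {L1}.
set s3 := run (Nset "masks" _ _) _.
pose Inv i (s' : state R) := [/\ nmem s' "codes" 0 = B ^ i, nmem s' "masks" 0 = 2 ^ i
  & forall r, r < i -> nmem s' "pow" r = B ^ r].
have rows3 : neval s3 (Nvar "rows") = N by [].
have ag3 : agree [:: "base"; "codes"; "masks"]%string s2 s3.
  have := run_agree ("base" ::= "omega" + 1;; "codes" ::= 1;; "masks" ::= 1)%stmt s2.
  by rewrite !run_seq.
have sI3 : inputs s3 by exact: inputs_agree ag3 sI2.
have base3 : nmem s3 "base" 0 = B by rewrite /= /update /= (in_omega sI2) addn1.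
have [] : Inv N (run L2 s3).
  apply: run_for => // i s' _ [ag _] [cE mE pE].
  rewrite !runE /=; split; rewrite /= /update /=.
  - by rewrite cE ag // base3 expnSr.
  - by rewrite mE expnSr.
  - move=> r; rewrite ltnS leq_eqVlt; case: eqP => [-> //|_ /= lt_r]; exact: pE.
move=> cE mE pE; split=> //.
- exact: inputs_agree (run_agree _ _) sI3.
- by rewrite run_nmem.
- by rewrite run_nmem.
Qed.

Lemma run_env c s :
  all (fun x => ~~ named (writes c) x) env_names -> env s -> env (run c s).
Proof. by move=> cN; exact: env_agree (run_agree c s). Qed.

Lemma env_nset s x i v :
  all (fun y => ~~ named [:: x] y) env_names -> env s -> env (nset s x i v).
Proof. by move=> xN; apply: env_agree xN _; apply: agree_nset; rewrite /= eqb_refl_string. Qed.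

(** * Feasibility of codes *)

Definition coordinate (r a : nat) : nat := r %/ k ^ a %% k.

Definition differ (r q m : nat) : nat := \sum_(a < m) (coordinate r a != coordinate q a).

(** Follows the program, which overwrites the distance at each differing place, so the last such
    place decides. If [differ] is 1 this is the Manhattan distance, and [conflict] holds in no other
    case. The sum of the two truncated differences is the absolute difference. *)
Fixpoint dist (r q m : nat) : nat :=
  if m is m'.+1 then
    if coordinate r m' != coordinate q m'
    then (coordinate r m' - coordinate q m') + (coordinate q m' - coordinate r m')
    else dist r q m'
  else 0.

(** A digit stores at most one entry of its row, so the row clause of [feasible] is built into the
    encoding. What is left is the clause about columns: two entries share a column when their
    non-zero digits agree. A row never conflicts with itself, as [differ] is then 0. *)
Definition conflict (c r q : nat) : bool :=
  [&& 0 < digit_at c r, digit_at c r == digit_at c q,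
      differ r q d.-1 == 1 & dist r q d.-1 < omega].

Definition feasible_code (c : nat) : bool :=
  all (fun r => all (fun q => ~~ conflict c r q) (iota 0 N)) (iota 0 N).

(** The nested loops of [compute_feasible] are named so that each has its own invariant; the program
    unfolds to them by conversion. *)
Definition compare_rows : stmt :=
  (For "a" ("d" - 1) (
     "x" ::= ("r" %/ "place") %% "k";;
     "y" ::= ("s" %/ "place") %% "k";;
     If (~~ ("x" == "y")) (
       "differ" ::= "differ" + 1;;
       "dist" ::= ("x" - "y") + ("y" - "x"))
       Skip;;
     "place" ::= "place" * "k"))%stmt.

Definition check_pair : stmt :=
  (If ((0 < digit "c" "r") && (digit "c" "r" == digit "c" "s")) (
     "differ" ::= 0;;
     "dist" ::= 0;;
     "place" ::= 1;;
     compare_rows;;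
     If (("differ" == 1) && ("dist" < "omega")) (Nset "feas" "c" 0) Skip)
     Skip)%stmt.

Definition check_rows : stmt := For "r" "rows" (For "s" "rows" check_pair).

Lemma compute_feasibleE :
  compute_feasible = For "c" "codes" (Seq (Nset "feas" "c" 1) check_rows).
Proof. by []. Qed.

Lemma compare_rows_run s r q : env s ->
    nmem s "differ" 0 = 0 -> nmem s "dist" 0 = 0 -> nmem s "place" 0 = 1 ->
    nmem s "r" 0 = r -> nmem s "s" 0 = q ->
  nmem (run compare_rows s) "differ" 0 = differ r q d.-1 /\
  nmem (run compare_rows s) "dist" 0 = dist r q d.-1.
Proof.
move=> sE differ0 dist0 place1 sr sq.
pose Inv i (s' : state R) := [/\ nmem s' "place" 0 = k ^ i, nmem s' "differ" 0 = differ r q i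
  & nmem s' "dist" 0 = dist r q i].
suff [] : Inv d.-1 (run compare_rows s) by [].
apply: run_for; first by rewrite /= (in_d sE) subn1.
  by split=> //; rewrite /differ big_ord0.
move=> i s' _ [ag _] [plE diE dsE].
have kE : nmem s' "k" 0 = k by rewrite ag // (in_k sE).
have rE : nmem s' "r" 0 = r by rewrite ag.
have qE : nmem s' "s" 0 = q by rewrite ag.
rewrite !run_seq run_if /= /update /= rE qE kE plE -/(coordinate r i) -/(coordinate q i).
have differS : differ r q i.+1 = differ r q i + (coordinate r i != coordinate q i).
  by rewrite /differ big_ord_recr.
case E: (coordinate r i == coordinate q i); split;
  by rewrite ?differS /= /update /= ?E /= ?plE ?kE ?expnSr ?diE ?dsE ?addn0 ?rE ?qE.
Qed.

Lemma check_pair_run s c r q : env s ->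
    nmem s "c" 0 = c -> nmem s "r" 0 = r -> nmem s "s" 0 = q -> r < N -> q < N ->
  forall x, nmem (run check_pair s) "feas" x =
    if (x == c) && conflict c r q then 0 else nmem s "feas" x.
Proof.
move=> sE sc sr sq rN qN x; rewrite run_if /=.
rewrite sc sr sq (env_base sE) !(env_pow sE) // -/(digit_at c r) -/(digit_at c q) /conflict.
case: (0 < digit_at c r); last by rewrite /= andbF.
case: (digit_at c r == digit_at c q); last by rewrite /= andbF.
rewrite !run_seq /=.
set s1 := run ("place" ::= 1) _.
have s1E : env s1 by rewrite /s1 -!run_seq; apply: run_env.
have [di ds] : nmem (run compare_rows s1) "differ" 0 = differ r q d.-1 /\
    nmem (run compare_rows s1) "dist" 0 = dist r q d.-1.
  by apply: compare_rows_run; rewrite // /s1 /= /update /=.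
have s2E : env (run compare_rows s1) by exact: run_env.
rewrite run_if /= di ds (in_omega s2E).
case: ((differ r q d.-1 == 1) && _); last by rewrite andbF !run_nmem.
by rewrite andbT /= /update /= !run_nmem //= /update /= sc.
Qed.

Lemma check_rows_run s c : env s -> nmem s "c" 0 = c ->
  forall x, nmem (run check_rows s) "feas" x =
    if (x == c) && ~~ feasible_code c then 0 else nmem s "feas" x.
Proof.
move=> sE sc.
pose P r i := all (fun q => ~~ conflict c r q) (iota 0 i).
pose Inv i (s' : state R) := forall x, nmem s' "feas" x =
  if (x == c) && ~~ all (P^~ N) (iota 0 i) then 0 else nmem s "feas" x.
suff : Inv N (run check_rows s) by [].
apply: (@run_for _ Inv); first exact: env_rows.
  by move=> x; rewrite andbF.
move=> r s1 rN ag1 Inv1.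
set s1' := nset s1 "r" 0 r.
have ag1' := agree_index 0 r ag1.
have s1E : env s1' by apply: env_agree ag1' sE.
pose Inv2 i (s' : state R) := forall x, nmem s' "feas" x =
  if (x == c) && ~~ P r i then 0 else nmem s1' "feas" x.
have : Inv2 N (run (For "s" "rows" check_pair) s1').
  apply: (@run_for _ Inv2); first exact: env_rows.
    by move=> x; rewrite andbF.
  move=> q s2 qN ag2 Inv2q x.
  have ag2' := agree_index 0 q ag2.
  rewrite (@check_pair_run _ c r q) //; last first.
  - by rewrite ag2'.1.
  - by rewrite ag2'.1 // ag1'.1.
  - by apply: env_agree ag2' s1E.
  rewrite [nmem _ "feas" x]Inv2q /P all_iotaS negb_and negbK.
  by case: (x == c) => //=; case: (conflict c r q); rewrite ?orbT ?orbF.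
move=> run2 x; rewrite run2 [nmem s1' "feas" x]Inv1 all_iotaS negb_and.
by case: (x == c) => //=; case: (P r N); rewrite ?orbT ?orbF.
Qed.

Lemma compute_feasible_run s : env s ->
  forall c, c < A -> nmem (run compute_feasible s) "feas" c = feasible_code c.
Proof.
move=> sE; rewrite compute_feasibleE.
pose Inv i (s' : state R) := forall c, c < i -> nmem s' "feas" c = feasible_code c.
suff : Inv A (run (For "c" "codes" (Seq (Nset "feas" "c" 1) check_rows)) s) by [].
apply: (@run_for _ Inv); first exact: env_codes.
  by [].
move=> c s1 _ ag1 Inv1.
have s1E : env s1 by apply: env_agree ag1 sE.
move=> x; rewrite ltnS leq_eqVlt run_seq (@check_rows_run _ c) /=; last 2 first.
- by apply: run_env => //; exact: env_nset.
- by [].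
rewrite /update /=; case: eqP => [->|_] /= => [|/Inv1->//].
by case: (feasible_code c).
Qed.

(** In the window at [j], digit [x] is column [j - omega + x] of the network, stored at position
    [j + x - 1]. Positivity stands for the presence of a vertex, as the array of the network is
    nowhere negative. *)
Definition present (j c : nat) : bool :=
  all (fun r => (0 < digit_at c r) ==> (0 < g (j + digit_at c r - 1) r)%R) (iota 0 N).

Definition admissible (j c : nat) : bool := feasible_code c && present j c.

Lemma dig_le c r : digit_at c r <= omega.
Proof. by rewrite -ltnS ltn_mod. Qed.

Lemma unmarked_test s c j vc vj r : env s ->
    neval s c = vc -> neval s j = vj -> nmem s "r" 0 = r -> vj <= n -> r < N ->
  beval s ((0 < digit c "r") &&
    ~~ Brlt Rzero "G".[(j + digit c "r" - 1) * "rows" + "r"])%bexp =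
  ~~ ((0 < digit_at vc r) ==> (0 < g (vj + digit_at vc r - 1) r)%R).
Proof.
move=> sE cE jE rE jn rN; rewrite /= cE jE rE (env_rows sE) (env_base sE) (env_pow sE) //.
rewrite -/(digit_at vc r) negb_imply.
case: (ltnP 0 (digit_at vc r)) => //= dig_gt0; rewrite (in_G sE) //.
by have := dig_le vc r; lia.
Qed.

Lemma test_feasible_in_run res c j s vc vj :
    (res = "ok") \/ (res = "okcand") -> env s ->
    (forall s', agree [:: res; "r"] s s' -> neval s' c = vc /\ neval s' j = vj) ->
    vj <= n -> nmem s "feas" vc = feasible_code vc ->
  nmem (run (test_feasible_in res c j) s) res 0 = admissible vj vc.
Proof.
move=> resE sE cjE jn feasE.
have resN : all (fun x => ~~ named [:: res; "r"] x) env_names by case: resE => ->.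
have resr : String.eqb res "r" = false by case: resE => ->.
rewrite /test_feasible_in run_seq; set s1 := run (Nset res 0 _) s.
have ag1 : agree [:: res; "r"] s s1.
  by apply: agree_nset; rewrite /= eqb_refl_string.
pose Inv i (s' : state R) := nmem s' res 0 = feasible_code vc &&
  all (fun r => (0 < digit_at vc r) ==> (0 < g (vj + digit_at vc r - 1) r)%R) (iota 0 i).
apply: (@run_for _ Inv).
- by have := env_rows (env_agree resN ag1 sE).
- rewrite /Inv andbT /s1 /= /update eqb_refl_string /=.
  by case: (cjE s) => // -> _.
move=> r s2 rN ag2 Inv2.
set s3 := nset s2 "r" 0 r.
have ag3 : agree [:: res; "r"] s s3.
  apply: (agree_trans ag1); apply: (@agree_trans _ _ _ s2); last first.
    by apply: agree_nset; rewrite /= orbT.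
  by apply: agree_sub ag2 => y; rewrite /= !orbF orbC.
have s3E := env_agree resN ag3 sE; have [c3 j3] := cjE _ ag3.
have r3 : nmem s3 "r" 0 = r by [].
rewrite /Inv all_iotaS andbA run_if (@unmarked_test s3 c j vc vj r) //.
have res3 : nmem s3 res 0 = nmem s2 res 0 by rewrite /= /update resr.
case: (_ ==> _) => /=; first by rewrite andbT -Inv2 -res3.
by rewrite /update eqb_refl_string andbF.
Qed.

(** Going back one column shifts an entry of the window one column to the right. An entry in the
    last column drops out; its row, like an empty one, can only have an entry in the new first
    column, and bit [r] of the mask decides whether it does. *)
Definition extension_digit (c m r : nat) : nat :=
  if 0 < digit_at c r < omega then (digit_at c r).+1 else m %/ 2 ^ r %% 2.

Definition extension (c m : nat) : nat := \sum_(r < N) extension_digit c m r * B ^ r.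

Lemma predecessor_candidate_run s c m : env s ->
    nmem s "c" 0 = c -> nmem s "mask" 0 = m ->
  nmem (run predecessor_candidate s) "cand" 0 = extension c m.
Proof.
move=> sE sc sm; rewrite /predecessor_candidate !run_seq.
set s1 := run ("bits" ::= "mask") _.
have s1E : env s1 by rewrite /s1 -run_seq; exact: run_env.
pose Inv i (s' : state R) := nmem s' "bits" 0 = m %/ 2 ^ i /\
  nmem s' "cand" 0 = \sum_(r < i) extension_digit c m r * B ^ r.
suff [] : Inv N (run (For "r" "rows" (
    If ((0 < digit "c" "r") && (digit "c" "r" < "omega"))
      ("cand" ::= "cand" + (digit "c" "r" + 1) * "pow".["r"])
      ("cand" ::= "cand" + ("bits" %% 2) * "pow".["r"]);;
    "bits" ::= "bits" %/ 2)%stmt) s1) by [].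
apply: (@run_for _ Inv).
- exact: env_rows.
- by split; rewrite ?big_ord0 ?expn0 ?divn1 /s1 /= /update //= sm.
move=> r s2 rN ag2 [bits2 cand2]; rewrite run_seq run_if.
set s3 := nset s2 "r" 0 r.
have ag3 := agree_index 0 r ag2.
have s3E : env s3 by exact: env_agree ag3 s1E.
have c3 : nmem s3 "c" 0 = c by rewrite ag3.1.
have dE : neval s3 (digit "c" "r") = digit_at c r by exact: digitE.
have powE : nmem s3 "pow" r = B ^ r by exact: env_pow.
rewrite /= in dE; rewrite /= -[update _ _ _ _ "omega" 0]/(nmem s3 "omega" 0) (in_omega s3E) dE.
rewrite /Inv big_ord_recr /= {2}/extension_digit.
case: ifP => _; split; rewrite /= /update /= ?bits2 ?cand2 ?addn1 ?expnSr ?divnMA //.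
  by rewrite -[in RHS]dE /= -powE.
by rewrite -powE.
Qed.

Lemma extension_digit_lt c m r : extension_digit c m r < B.
Proof.
rewrite /extension_digit; case: ifP => [/andP[_ lt_r]|_]; first by rewrite ltnS.
by apply: (@leq_trans 2); rewrite ?ltn_mod.
Qed.

Lemma extension_lt c m : extension c m < A.
Proof. by apply: digits_lt => r _; exact: extension_digit_lt. Qed.

Lemma dig_extension c m r : r < N -> digit_at (extension c m) r = extension_digit c m r.
Proof. by move=> rN; rewrite /digit_at digits_nth // => q _; exact: extension_digit_lt. Qed.

(** * Maximisation by scanning candidates *)

Definition optimum (mis : nat -> R) (P : nat -> Prop) (b : nat) : Prop :=
  P b /\ forall a, P a -> (mis a <= mis b)%R.

(** Common invariant of the scan over masks and of the final scan over codes. [P] holds for the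
    candidates met so far; while there are none, [best] may hold a stale value, which [found]
    guards. *)
Definition scanned j (P : nat -> Prop) s : Prop :=
  (nmem s "found" 0 = 0 /\ forall a, ~ P a) \/
  (nmem s "found" 0 = 1 /\
     optimum (fun a => rmem s "MIS" (j * A + a)) P (nmem s "best" 0)).

Lemma scanned_ext j (P Q : nat -> Prop) s s' : (forall a, P a <-> Q a) ->
    nmem s' "found" 0 = nmem s "found" 0 -> nmem s' "best" 0 = nmem s "best" 0 ->
    (forall x, rmem s' "MIS" x = rmem s "MIS" x) ->
  scanned j P s -> scanned j Q s'.
Proof.
move=> PQ fE bE mE [[f0 noP]|[f1 [Pb maxb]]].
  by left; rewrite fE; split=> // a /PQ; exact: noP.
right; rewrite fE /optimum bE; split=> //; split; first exact/PQ.
by move=> a /PQ; rewrite !mE; exact: maxb.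
Qed.

Lemma improve_run cand j s vc vj P : env s -> neval s cand = vc -> neval s j = vj ->
  scanned vj P s -> scanned vj (fun a => P a \/ a = vc) (run (improve cand j) s).
Proof.
move=> sE cE jE Ps; rewrite /improve !run_if /=.
case: Ps => [[f0 noP]|[f1 [Pb maxb]]].
  rewrite f0 /=; right; rewrite /= /update /=; split=> //; split; rewrite cE; first by right.
  by move=> a [/noP//|->].
rewrite f1 /= jE cE (env_codes sE).
case: ltP => [lt_b|le_b]; right; rewrite /= ?/update /= f1 ?cE; split=> //; split.
- by right.
- by move=> a [/maxb/le_trans->//|->//]; exact: ltW.
- by left.
- by move=> a [/maxb//|->].
Qed.

(** Phrased through masks, as the program enumerates them. Several masks may give the same code,
    which does not affect the maximum. [candidateP] recovers consistency. *)
Definition candidate (j c a : nat) : Prop :=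
  exists2 m, m < 2 ^ N & a = extension c m /\ admissible j a.

(** Position [j + omega - 1] of the storage is column [j] of the network. *)
Definition last_weight (j c : nat) : R :=
  (\sum_(r < N | digit_at c r == omega) g (j + omega - 1) r)%R.

Definition table_entry (mis : nat -> R) (prd : nat -> nat) (j c : nat) : Prop :=
  if admissible j c then
    optimum (fun a => mis (j.-1 * A + a)) (candidate j.-1 c) (prd (j * A + c)) /\
    mis (j * A + c) = (last_weight j c + mis (j.-1 * A + prd (j * A + c)))%R
  else mis (j * A + c) = 0%R.

Definition feasible_table s : Prop :=
  forall c, c < A -> nmem s "feas" c = feasible_code c.

Lemma A_gt0 : 0 < A. Proof. by rewrite expn_gt0. Qed.

(** With mask 0 the new first column is empty, so a conflict after the shift would already be one in
    [c]. Together with [extension0_present] this gives every admissible code a predecessor, so that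
    the scan over masks always sets [best]. *)
Lemma extension0_feasible c : feasible_code c -> feasible_code (extension c 0).
Proof.
move=> /allP cF; apply/allP => r rN; apply/allP => q qN.
move: (cF r rN) => /allP /(_ q qN); move: rN qN; rewrite !mem_iota !add0n => rN qN.
apply: contra; rewrite /conflict !dig_extension // /extension_digit !div0n mod0n.
case: ifP => [/andP[r0 _]|_]; last by rewrite ltnn.
case: ifP => [/andP[q0 _]|_] /=; last by [].
by rewrite eqSS r0.
Qed.

Lemma extension0_present j c : 0 < j -> present j c -> present j.-1 (extension c 0).
Proof.
move=> j0 /allP cP; apply/allP => r rN; have := cP r rN; move: rN.
rewrite mem_iota add0n => rN; rewrite dig_extension // /extension_digit div0n mod0n.
case: ifP => //= /andP[-> _] /=.
(* The window moves left and the entry moves right within it: the place in the network is the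
   same. *)
by have -> : j.-1 + (digit_at c r).+1 - 1 = j + digit_at c r - 1 by lia.
Qed.

Lemma candidate_extension0 j c :
  0 < j -> admissible j c -> candidate j.-1 c (extension c 0).
Proof.
move=> j0 /andP[cF cP]; exists 0; first by rewrite expn_gt0.
by split=> //; rewrite /admissible extension0_feasible ?extension0_present.
Qed.

Definition scan_candidate : stmt :=
  (predecessor_candidate;;
   test_feasible_in "okcand" "cand" ("j" - 1);;
   If ("okcand" == 1) (improve "cand" ("j" - 1)) Skip)%stmt.

Lemma scan_candidates_run s c j : env s -> feasible_table s ->
    nmem s "c" 0 = c -> nmem s "j" 0 = j -> 0 < j <= n -> nmem s "found" 0 = 0 ->
  scanned j.-1 (candidate j.-1 c) (run (For "mask" "masks" scan_candidate) s).
Proof.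
move=> sE sF sc sj /andP[j0 jn] f0.
pose Inv i (s' : state R) := scanned j.-1
  (fun a => exists2 m, m < i & a = extension c m /\ admissible j.-1 a) s'.
have : Inv (2 ^ N) (run (For "mask" "masks" scan_candidate) s); last by [].
apply: (@run_for _ Inv).
- exact: env_masks.
- by left; split=> // a [].
move=> m s1 mN ag1 Inv1; rewrite /scan_candidate 2!run_seq.
have := agree_index 0 m ag1; set s2 := nset s1 "mask" 0 m => ag2.
have s2E : env s2 by exact: env_agree ag2 sE.
have cand3 : nmem (run predecessor_candidate s2) "cand" 0 = extension c m.
  by apply: predecessor_candidate_run; rewrite // ag2.1.
have ag3 := run_agree predecessor_candidate s2.
have s3E : env (run predecessor_candidate s2) by exact: run_env.
set s3 := run predecessor_candidate s2 in cand3 ag3 s3E *.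
have j3 : nmem s3 "j" 0 = j by rewrite ag3.1 // ag2.1.
have ok4 : nmem (run (test_feasible_in "okcand" "cand" ("j" - 1)) s3) "okcand" 0 =
    admissible j.-1 (extension c m).
  apply: test_feasible_in_run => //; first by right.
  - by move=> s' ag' /=; rewrite !ag'.1 // cand3 j3 subn1.
  - by lia.
  - by rewrite ag3.1 // ag2.1 //; apply: sF; exact: extension_lt.
have ag4 := run_agree (test_feasible_in "okcand" "cand" ("j" - 1)) s3.
have s4E : env (run (test_feasible_in "okcand" "cand" ("j" - 1)) s3) by exact: run_env.
set s4 := run _ s3 in ok4 ag4 s4E *.
have Inv4 : Inv m s4.
  by apply: scanned_ext Inv1 => // *; rewrite ?ag4.1 ?ag4.2 ?ag3.1 ?ag3.2.
rewrite run_if /= ok4.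
case: (boolP (admissible _ _)) => [okm|Nokm] /=.
  apply: scanned_ext (improve_run s4E (vc := extension c m) _ _ Inv4) => //.
  - move=> a; split=> [[[m' lt_m' am']|->]|[m']].
    + by exists m' => //; exact: ltnW.
    + by exists m.
    + rewrite ltnS leq_eqVlt => /orP[/eqP->[]|lt_m' am']; first by right.
      by left; exists m'.
  - by rewrite /= ag4.1.
  - by rewrite /= ag4.1 // j3 subn1.
apply: scanned_ext Inv4 => // a; split=> [[m' lt_m' am']|[m']].
  by exists m' => //; exact: ltnW.
rewrite ltnS leq_eqVlt => /orP[/eqP->[-> okm]|lt_m' am']; last by exists m'.
by rewrite okm in Nokm.
Qed.

(** * Filling the tables *)

Definition sum_last_column : stmt :=
  (For "r" "rows" (
     If (digit "c" "r" == "omega")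
       (Rset "product" 0
         ("product".[0] + "G".[("j" + "omega" - 1) * "rows" + "r"]))
       Skip))%stmt.

Lemma sum_last_column_run s c j : env s ->
    nmem s "c" 0 = c -> nmem s "j" 0 = j -> 0 < j <= n -> rmem s "product" 0 = 0%R ->
  rmem (run sum_last_column s) "product" 0 = last_weight j c.
Proof.
move=> sE sc sj /andP[j0 jn] p0.
pose Inv i (s' : state R) :=
  rmem s' "product" 0 = (\sum_(r < i | digit_at c r == omega) g (j + omega - 1) r)%R.
apply: (@run_for _ Inv).
- exact: env_rows.
- by rewrite /Inv big_ord0.
move=> r s1 rN ag1 Inv1; have := agree_index 0 r ag1.
have [r2 p2] : nmem (nset s1 "r" 0 r) "r" 0 = r /\
    rmem (nset s1 "r" 0 r) "product" 0 = rmem s1 "product" 0 by [].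
move: (nset s1 "r" 0 r) r2 p2 => s2 r2 p2 ag2.
have s2E : env s2 by exact: env_agree ag2 sE.
have c2 : nmem s2 "c" 0 = c by rewrite ag2.1.
have j2 : nmem s2 "j" 0 = j by rewrite ag2.1.
have dE : neval s2 (digit "c" "r") = digit_at c r by exact: digitE.
rewrite run_if /=; rewrite /= in dE; rewrite dE (in_omega s2E).
rewrite /Inv big_mkcond big_ord_recr -big_mkcond /= -Inv1 -p2.
case: eqP => _; last by rewrite addr0.
rewrite /= /update /= j2 (in_omega s2E) (env_rows s2E) r2 (in_G s2E) //; lia.
Qed.

Definition fill_entry : stmt :=
  (test_feasible_in "ok" "c" "j";;
   If ("ok" == 1) (
     "found" ::= 0;;
     For "mask" "masks" scan_candidate;;
     Rset "product" 0 Rzero;;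
     sum_last_column;;
     Rset "MIS" ("j" * "codes" + "c")
       ("product".[0] + "MIS".[("j" - 1) * "codes" + "best"]);;
     Nset "pred" ("j" * "codes" + "c") "best")
     Skip)%stmt.

Lemma fill_tablesE :
  fill_tables = For "t" "n" (Seq ("j" ::= "t" + 1)%stmt (For "c" "codes" fill_entry)).
Proof. by []. Qed.

Lemma index_inj j j' c c' : c < A -> c' < A ->
  (j * A + c == j' * A + c') = (j == j') && (c == c').
Proof.
move=> cA c'A; apply/eqP/andP => [E|[/eqP-> /eqP->//]].
have := congr1 (divn^~ A) E; rewrite !divnMDl ?A_gt0 // !divn_small // !addn0 => jj.
by move: E; rewrite jj => /addnI ->.
Qed.

Lemma optimum_ext (mis mis' : nat -> R) P b :
  (forall a, P a -> mis' a = mis a) -> optimum mis P b -> optimum mis' P b.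
Proof. by move=> mE [Pb maxb]; split=> // a Pa; rewrite !mE // maxb. Qed.

Lemma fill_entry_run s c j : env s -> feasible_table s ->
    nmem s "c" 0 = c -> nmem s "j" 0 = j -> c < A -> 0 < j <= n ->
    rmem s "MIS" (j * A + c) = 0%R ->
  [/\ table_entry (rmem (run fill_entry s) "MIS") (nmem (run fill_entry s) "pred") j c,
      forall x, x != j * A + c -> rmem (run fill_entry s) "MIS" x = rmem s "MIS" x
    & forall x, x != j * A + c -> nmem (run fill_entry s) "pred" x = nmem s "pred" x].
Proof.
move=> sE sF sc sj cA /andP[j0 jn] mis0; rewrite /fill_entry run_seq run_if.
have ag1 := run_agree (test_feasible_in "ok" "c" "j") s.
have s1E : env (run (test_feasible_in "ok" "c" "j") s) by exact: run_env.
have : nmem (run (test_feasible_in "ok" "c" "j") s) "ok" 0 = admissible j c.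
  apply: test_feasible_in_run => //; first by left.
  - by move=> s' ag' /=; rewrite !ag'.1.
  - exact: sF.
move: (run (test_feasible_in "ok" "c" "j") s) ag1 s1E => s1 ag1 s1E ok1.
rewrite /= ok1 /table_entry.
case: (boolP (admissible j c)) => [okc|Nokc] /=; last by split=> *; rewrite ?ag1.1 ?ag1.2.
rewrite run_seq; set s2 := run ("found" ::= 0) s1.
have ag2 : agree [:: "found"] s1 s2 by exact: agree_nset.
have s2E : env s2 by exact: env_agree ag2 s1E.
have sc2 : scanned j.-1 (candidate j.-1 c) (run (For "mask" "masks" scan_candidate) s2).
  apply: scan_candidates_run; rewrite ?j0 //.
  - by move=> a aA; rewrite ag2.1 // ag1.1 // sF.
  - by rewrite ag2.1 // ag1.1.
  - by rewrite ag2.1 // ag1.1.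
rewrite run_seq; have ag3 := run_agree (For "mask" "masks" scan_candidate) s2.
have s3E : env (run (For "mask" "masks" scan_candidate) s2) by exact: run_env.
move: (run (For _ _ _) s2) ag3 s3E sc2 => s3 ag3 s3E.
case=> [[_ /(_ (extension c 0))[]]|[_ opt3]]; first exact: candidate_extension0.
rewrite run_seq; set s4 := run (Rset "product" 0 Rzero) s3.
have ag4 : agree [:: "product"] s3 s4 by exact: agree_rset.
have s4E : env s4 by exact: env_agree ag4 s3E.
rewrite run_seq; have ag5 := run_agree sum_last_column s4.
have s5E : env (run sum_last_column s4) by exact: run_env.
have : rmem (run sum_last_column s4) "product" 0 = last_weight j c.
  by apply: sum_last_column_run; rewrite // ?j0 // ag4.1 // ag3.1 // ag2.1 // ag1.1.
move: (run sum_last_column s4) ag5 s5E => s5 ag5 s5E pr5.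
have j5 : nmem s5 "j" 0 = j by rewrite ag5.1 // ag4.1 // ag3.1 // ag2.1 // ag1.1.
have c5 : nmem s5 "c" 0 = c by rewrite ag5.1 // ag4.1 // ag3.1 // ag2.1 // ag1.1.
have b5 : nmem s5 "best" 0 = nmem s3 "best" 0 by rewrite ag5.1 // ag4.1.
have mis5 x : rmem s5 "MIS" x = rmem s "MIS" x.
  by rewrite ag5.2 // ag4.2 // ag3.2 // ag2.2 // ag1.2.
have mis3 x : rmem s3 "MIS" x = rmem s "MIS" x.
  by rewrite ag3.2 // ag2.2 // ag1.2.
have prd5 x : nmem s5 "pred" x = nmem s "pred" x.
  by rewrite ag5.1 // ag4.1 // ag3.1 // ag2.1 // ag1.1.
have [[m _ [bestE _]] _] := opt3.
have bestA : nmem s3 "best" 0 < A by rewrite bestE extension_lt.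
have lt_j : (j.-1 == j) = false by lia.
rewrite run_seq /= /update /= j5 c5 b5 pr5 (env_codes s5E) subn1 !eqxx.
split=> [|x /negPf->//|x /negPf->//].
(* The maximum was taken over row [j.-1] of the table, which the write into row [j] does not
   touch. *)
rewrite index_inj // lt_j /=; split=> //.
apply: optimum_ext opt3 => a [m' _ [-> _]].
by rewrite index_inj ?extension_lt // lt_j /= mis5 mis3.
Qed.

(** Besides its own cell, an entry depends on row [j.-1] at codes below [A]; these are the cells
    that later writes must preserve. *)
Lemma table_entry_ext (mis mis' : nat -> R) (prd prd' : nat -> nat) j c :
    mis' (j * A + c) = mis (j * A + c) -> prd' (j * A + c) = prd (j * A + c) ->
    (forall a, a < A -> mis' (j.-1 * A + a) = mis (j.-1 * A + a)) ->
  table_entry mis prd j c -> table_entry mis' prd' j c.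
Proof.
move=> misE prdE misE'; rewrite /table_entry misE prdE.
case: (admissible j c) => // -[opt ->].
have [[m _ [bE _]] _] := opt; rewrite misE' ?bE ?extension_lt //; split=> //.
rewrite -bE; apply: optimum_ext opt => a [m' _ [-> _]].
by rewrite misE' ?extension_lt.
Qed.

(** The zeros beyond row [t] are part of the invariant because inadmissible cells are skipped and
    keep their initial value. *)
Definition filled (t : nat) s : Prop :=
  [/\ rmem s "MIS" 0 = 0%R,
      forall j c, 0 < j <= t -> c < A ->
        table_entry (rmem s "MIS") (nmem s "pred") j c
    & forall j c, t < j <= n -> c < A -> rmem s "MIS" (j * A + c) = 0%R].

Lemma fill_row_run s t : env s -> feasible_table s -> nmem s "j" 0 = t.+1 -> t < n ->
  filled t s -> filled t.+1 (run (For "c" "codes" fill_entry) s).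
Proof.
move=> sE sF sj tn [mis0 done_t todo_t].
pose Inv i (s' : state R) :=
  [/\ rmem s' "MIS" 0 = 0%R,
      forall j c, (0 < j <= t) || (j == t.+1) && (c < i) -> c < A ->
        table_entry (rmem s' "MIS") (nmem s' "pred") j c
    & forall j c, (t.+1 < j <= n) || (j == t.+1) && (i <= c) -> c < A ->
        rmem s' "MIS" (j * A + c) = 0%R].
suff [mis0' done' todo'] : Inv A (run (For "c" "codes" fill_entry) s).
  split=> // j c.
    by move=> jt cA; apply: done' => //; lia.
  by move=> jt; apply: todo'; rewrite jt.
apply: (@run_for _ Inv); first exact: env_codes.
  split=> // j c jt cA; first by apply: done_t => //; lia.
  by apply: todo_t => //; lia.
move=> c s1 cA ag1 [mis1 done1 todo1].
have := agree_index 0 c ag1; set s2 := nset s1 "c" 0 c => ag2.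
have s2E : env s2 by exact: env_agree ag2 sE.
have s2F : feasible_table s2 by move=> a aA; rewrite ag2.1 // sF.
have [|||||new misE prdE] := @fill_entry_run s2 c t.+1 s2E s2F => //.
- by rewrite ag2.1.
- by apply: todo1 => //; rewrite eqxx leqnn orbT.
have AP := A_gt0; split.
- by rewrite misE // eq_sym -lt0n addn_gt0 muln_gt0 AP.
- move=> i a; case: (boolP ((i == t.+1) && (a == c))) => [/andP[/eqP-> /eqP->] _ _ //|ia].
  move=> it aA; apply: (@table_entry_ext (rmem s1 "MIS") _ (nmem s1 "pred")).
  + by rewrite misE // index_inj // ia.
  + by rewrite prdE // index_inj // ia.
  + move=> b bA; rewrite misE // index_inj //.
    by move: it; case: eqP => [|//] ; lia.
  + by apply: done1 => //; lia.
- move=> i a it aA; rewrite misE ?index_inj //; last by lia.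
  by apply: todo1 => //; lia.
Qed.

Lemma fill_tables_run s : env s -> feasible_table s -> filled 0 s ->
  filled n (run fill_tables s).
Proof.
move=> sE sF s0; rewrite fill_tablesE.
apply: (@run_for _ filled) => //; first exact: (in_n sE).
move=> t s1 tn ag1 filled1; rewrite run_seq.
have := agree_index 0 t ag1.
have : nmem (nset s1 "t" 0 t) "t" 0 = t by [].
have : filled t (nset s1 "t" 0 t) by [].
move: (nset s1 "t" 0 t) => s2 filled2 t2 ag2.
have s2E : env s2 by exact: env_agree ag2 sE.
apply: fill_row_run => //.
- exact: env_nset.
- by move=> a aA; rewrite /= /update /= ag2.1 // sF.
- by rewrite /= /update /= t2 addn1.
Qed.

Lemma initialise_run s : env s -> filled 0 (run initialise s).
Proof.
move=> sE; rewrite /initialise run_seq; set s1 := run (Rset _ _ _) s.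
have ag1 : agree [:: "MIS"] s s1 by exact: agree_rset.
have s1E : env s1 by exact: env_agree ag1 sE.
pose Inv i (s' : state R) := rmem s' "MIS" 0 = 0%R /\
  forall j c, 0 < j <= i -> c < A -> rmem s' "MIS" (j * A + c) = 0%R.
suff [mis0 misE] : Inv n (run (For "t" "n" (For "c" "codes"
    (Rset "MIS" (("t" + 1) * "codes" + "c") Rzero))%stmt) s1).
  by split=> //; case.
apply: (@run_for _ Inv); first exact: (in_n s1E).
  by split=> // -[].
move=> t s2 tn ag2 [mis2 Inv2]; have := agree_index 0 t ag2.
have : nmem (nset s2 "t" 0 t) "t" 0 = t by [].
have : Inv t (nset s2 "t" 0 t) by [].
move: (nset s2 "t" 0 t) => s3 [mis3 Inv3] t3 ag3.
have s3E : env s3 by exact: env_agree ag3 s1E.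
pose Inv' i (s' : state R) := Inv t s' /\
  forall c, c < i -> rmem s' "MIS" (t.+1 * A + c) = 0%R.
suff [[mis4 Inv4] Inv4'] : Inv' A (run (For "c" "codes"
    (Rset "MIS" (("t" + 1) * "codes" + "c") Rzero))%stmt s3).
  split=> // j c /andP[j0]; rewrite leq_eqVlt => /orP[/eqP->|jt]; first exact: Inv4'.
  by apply: Inv4; rewrite j0.
apply: (@run_for _ Inv'); first exact: env_codes.
  by [].
move=> c s4 cA ag4 [[mis4 Inv4] Inv4']; have := agree_index 0 c ag4 => ag5.
have idx : neval (nset s4 "c" 0 c) (("t" + 1) * "codes" + "c")%nexp = t.+1 * A + c.
  have t4 : nmem s4 "t" 0 = t by rewrite ag4.1.
  by rewrite /= /update /= t4 ag4.1 // (env_codes s3E) addn1.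
have misE x : rmem (run (Rset "MIS" (("t" + 1) * "codes" + "c") Rzero) (nset s4 "c" 0 c))
    "MIS" x = if x == t.+1 * A + c then 0%R else rmem s4 "MIS" x by rewrite -idx.
split; first split.
- by rewrite misE; case: eqP.
- by move=> j a jt aA; rewrite misE; case: eqP => // _; exact: Inv4.
- by move=> a; rewrite ltnS leq_eqVlt misE eqn_add2l; case: eqP => //= _; exact: Inv4'.
Qed.

(** * Retrieval of the output *)

Lemma write_column_run s je j : env s ->
    (forall s', agree (writes (write_column je)) s s' -> neval s' je = j) ->
  (forall r, r < N -> nmem (run (write_column je) s) "I" ((j - 1) * N + r) =
     (digit_at (nmem s "best" 0) r == omega)) /\
  (forall x, x < (j - 1) * N \/ (j - 1) * N + N <= x ->
     nmem (run (write_column je) s) "I" x = nmem s "I" x).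
Proof.
move=> sE jE; set b := nmem s "best" 0.
pose Inv i (s' : state R) :=
  (forall r, r < i -> nmem s' "I" ((j - 1) * N + r) = (digit_at b r == omega)) /\
  (forall x, x < (j - 1) * N \/ (j - 1) * N + N <= x -> nmem s' "I" x = nmem s "I" x).
suff : Inv N (run (write_column je) s) by [].
apply: (@run_for _ Inv); [exact: env_rows|by []|].
move=> r s1 rN ag1 Inv1; have := agree_index 0 r ag1.
have : nmem (nset s1 "r" 0 r) "r" 0 = r by [].
have : Inv r (nset s1 "r" 0 r) by [].
move: (nset s1 "r" 0 r) => s2 [col2 out2] r2 ag2.
have s2E : env s2 by exact: env_agree ag2 sE.
have j2 : neval s2 je = j by exact: jE.
have dE : neval s2 (digit "best" "r") = digit_at b r.
  by apply: digitE => //; exact: (ag2.1 "best" 0 isT).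
have idx : neval s2 ((je - 1) * "rows" + "r")%nexp = (j - 1) * N + r.
  by rewrite /= j2 r2 (env_rows s2E).
have IE x : nmem (run (If (digit "best" "r" == "omega")
      (Nset "I" ((je - 1) * "rows" + "r") 1)
      (Nset "I" ((je - 1) * "rows" + "r") 0))%stmt s2) "I" x =
    if x == (j - 1) * N + r then (digit_at b r == omega) : nat else nmem s2 "I" x.
  rewrite run_if -idx; rewrite /= in dE.
  by rewrite /= dE (in_omega s2E); case: eqP.
split=> [q|x xN]; rewrite IE.
  by rewrite ltnS leq_eqVlt eqn_add2l; case: eqP => [->//|_] /=; exact: col2.
by case: eqP => [xE|_]; [lia|exact: out2].
Qed.

Definition follow_pred : stmt :=
  ("j" ::= "n" - "t";;
   "best" ::= "pred".["j" * "codes" + "best"];;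
   write_column ("j" - 1))%stmt.

Definition scan_last : stmt :=
  (For "c" "codes" (
     test_feasible_in "ok" "c" "n";;
     If ("ok" == 1) (improve "c" "n") Skip))%stmt.

Lemma retrieveE : retrieve =
  ("found" ::= 0;; scan_last;; write_column "n";; For "t" ("n" - 1) follow_pred)%stmt.
Proof. by []. Qed.

Lemma scan_last_run s : env s -> feasible_table s -> nmem s "found" 0 = 0 ->
  scanned n (fun a => a < A /\ admissible n a) (run scan_last s).
Proof.
move=> sE sF f0.
pose Inv i (s' : state R) := scanned n (fun a => a < i /\ admissible n a) s'.
apply: (@run_for _ Inv); first exact: env_codes.
  by left; split=> // a [].
move=> c s1 cA ag1 Inv1; have := agree_index 0 c ag1.
have : nmem (nset s1 "c" 0 c) "c" 0 = c by [].
have : Inv c (nset s1 "c" 0 c) by [].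
move: (nset s1 "c" 0 c) => s2 Inv2 c2 ag2.
have s2E : env s2 by exact: env_agree ag2 sE.
rewrite run_seq; have ag3 := run_agree (test_feasible_in "ok" "c" "n") s2.
have ok3 : nmem (run (test_feasible_in "ok" "c" "n") s2) "ok" 0 = admissible n c.
  apply: test_feasible_in_run => //; first by left.
  - by move=> s' ag' /=; rewrite !ag'.1 // c2 (in_n s2E).
  - by rewrite ag2.1 // sF.
have s3E : env (run (test_feasible_in "ok" "c" "n") s2) by exact: run_env.
move: (run (test_feasible_in "ok" "c" "n") s2) ag3 ok3 s3E => s3 ag3 ok3 s3E.
have Inv3 : Inv c s3 by apply: scanned_ext Inv2; rewrite ?ag3.1 // => x; rewrite ag3.2.
rewrite run_if /= ok3; case: (boolP (admissible n c)) => [okc|Nokc] /=.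
  apply: scanned_ext (improve_run s3E (vc := c) _ _ Inv3) => //.
  - move=> a; split=> [[[lt_a oka]|->]|[]]; rewrite ?ltnSn //.
      by split=> //; exact: ltnW.
    by rewrite ltnS leq_eqVlt => /orP[/eqP->|lt_a] oka; [right|left].
  - by rewrite /= ag3.1.
  - by rewrite /= (in_n s3E).
apply: scanned_ext Inv3 => // a; split=> [[lt_a oka]|[]].
  by split=> //; exact: ltnW.
by rewrite ltnS leq_eqVlt => /orP[/eqP-> okc|//]; rewrite okc in Nokc.
Qed.

(** Ensures that the final scan over the codes ends with [found] equal to 1. *)
Lemma admissible0 j : admissible j 0.
Proof.
have dig0 r : digit_at 0 r = 0 by rewrite /digit_at div0n mod0n.
apply/andP; split; apply/allP => r _; last by rewrite dig0.
by apply/allP => q _; rewrite /conflict dig0.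
Qed.

(* ws t is the array from which column n - t of the output is read. *)
Lemma retrieve_run s : env s -> feasible_table s ->
    let s' := run retrieve s in
    let mis := rmem s "MIS" in let prd := nmem s "pred" in
    exists ws : nat -> nat,
  [/\ optimum (fun a => mis (n * A + a)) (fun a => a < A /\ admissible n a) (ws 0),
      forall t, t < n.-1 -> ws t.+1 = prd ((n - t) * A + ws t)
    & forall t r, t < n -> r < N ->
        nmem s' "I" ((n - t - 1) * N + r) = (digit_at (ws t) r == omega)].
Proof.
move=> sE sF s' mis prd; rewrite {}/s' retrieveE run_seq.
set s1 := run ("found" ::= 0) s.
have ag1 : agree [:: "found"] s s1 by exact: agree_nset.
have s1E : env s1 by exact: env_agree ag1 sE.
have := @scan_last_run s1 s1E; rewrite run_seq.
have ag2 := run_agree scan_last s1; have s2E : env (run scan_last s1) by exact: run_env.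
move: (run scan_last s1) ag2 s2E => s2 ag2 s2E [].
- by move=> a aA; rewrite ag1.1 // sF.
- by [].
- by move=> [_ /(_ 0)[]]; split; [exact: A_gt0|exact: admissible0].
move=> [_ opt2]; pose ws := fix ws t :=
  if t is t'.+1 then prd ((n - t') * A + ws t') else nmem s2 "best" 0.
exists ws; split=> //.
  apply: optimum_ext opt2 => a _; by rewrite ag2.2 // ag1.2.
rewrite run_seq; have ag3 := run_agree (write_column "n") s2.
have [] := @write_column_run s2 "n" n s2E.
  by move=> x agx; rewrite /= agx.1 // (in_n s2E).
have s3E : env (run (write_column "n") s2) by exact: run_env.
move: (run (write_column "n") s2) ag3 s3E => s3 ag3 s3E col3 _.
pose Inv i (x : state R) := nmem x "best" 0 = ws i /\
  forall t r, t <= i -> r < N ->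
    nmem x "I" ((n - t - 1) * N + r) = (digit_at (ws t) r == omega).
suff [_ out4] : Inv n.-1 (run (For "t" ("n" - 1) follow_pred) s3).
  by move=> t r tn; apply: out4; lia.
apply: (@run_for _ Inv).
- by rewrite /= (in_n s3E) subn1.
- split; first by rewrite ag3.1.
  by move=> t r; rewrite leqn0 => /eqP-> rN; rewrite subn0 col3.
move=> t s4 tn ag4 Inv4; have := agree_index 0 t ag4.
have : nmem (nset s4 "t" 0 t) "t" 0 = t by [].
have : Inv t (nset s4 "t" 0 t) by [].
move: (nset s4 "t" 0 t) => s5 [best5 out5] t5 ag5.
have s5E : env s5 by exact: env_agree ag5 s3E.
rewrite /follow_pred run_seq; set s6 := run ("j" ::= "n" - "t") s5.
have j6 : nmem s6 "j" 0 = n - t by rewrite /s6 /= /update /= t5 (in_n s5E).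
have ag6 : agree [:: "j"] s5 s6 by exact: agree_nset.
have s6E : env s6 by exact: env_agree ag6 s5E.
rewrite run_seq; set s7 := run ("best" ::= _) s6.
have best7 : nmem s7 "best" 0 = ws t.+1.
  have -> : nmem s7 "best" 0 =
    nmem s6 "pred" (nmem s6 "j" 0 * nmem s6 "codes" 0 + nmem s6 "best" 0) by [].
  rewrite j6 (env_codes s6E) ag6.1 // [nmem s6 "best" 0]ag6.1 // best5.
  by rewrite ag5.1 // ag3.1 // ag2.1 // ag1.1.
have ag7 : agree [:: "best"] s6 s7 by exact: agree_nset.
have s7E : env s7 by exact: env_agree ag7 s6E.
have [|col8 out8] := @write_column_run s7 ("j" - 1)%nexp (n - t - 1) s7E.
  by move=> x agx; rewrite /= agx.1 // ag7.1 // j6.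
split; first by rewrite run_nmem // best7.
move=> t' r; rewrite leq_eqVlt => /orP[/eqP->|lt_t'] rN.
  by rewrite -best7 -col8 //; congr (nmem _ _ (_ * _ + _)); lia.
(* The columns written before lie to the right of the one written now. *)
rewrite out8; first by rewrite ag7.1 // ag6.1 // out5.
right; apply: leq_trans (leq_addr _ _); rewrite -mulSnr leq_mul2r; apply/orP; right; lia.
Qed.

(** The whole interface between the machine and the arrays: [dp_program_correct] uses nothing else
    about the execution. *)
Lemma dp_program_run s : inputs s ->
    let s' := run dp_program s in
    let mis := rmem s' "MIS" in let prd := nmem s' "pred" in
  [/\ mis 0 = 0%R,
      forall j c, 0 < j <= n -> c < A -> table_entry mis prd j c
    & exists ws : nat -> nat,
      [/\ optimum (fun a => mis (n * A + a)) (fun a => a < A /\ admissible n a) (ws 0),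
          forall t, t < n.-1 -> ws t.+1 = prd ((n - t) * A + ws t)
        & forall t r, t < n -> r < N ->
            nmem s' "I" ((n - t - 1) * N + r) = (digit_at (ws t) r == omega)]].
Proof.
move=> sI s'; rewrite {}/s' /dp_program run_seq.
have := setup_env sI; move: (run setup s) => s1 s1E.
rewrite run_seq; have := compute_feasible_run s1E; have : env (run compute_feasible s1).
  exact: run_env.
move: (run compute_feasible s1) => s2 s2E s2F.
rewrite run_seq; have := initialise_run s2E; have ag3 := run_agree initialise s2.
have s3E : env (run initialise s2) by exact: run_env.
have s3F : feasible_table (run initialise s2) by move=> c cA; rewrite ag3.1 // s2F.
move: (run initialise s2) s3E s3F => s3 s3E s3F filled3 {ag3}.
rewrite run_seq; have := fill_tables_run s3E s3F filled3.
have ag4 := run_agree fill_tables s3.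
have s4E : env (run fill_tables s3) by exact: run_env.
have s4F : feasible_table (run fill_tables s3) by move=> c cA; rewrite ag4.1 // s3F.
move: (run fill_tables s3) s4E s4F => s4 s4E s4F [mis4 done4 _] {ag4}.
have [ws [opt follow out]] := retrieve_run s4E s4F.
have ag5 := run_agree retrieve s4.
have misE x : rmem (run retrieve s4) "MIS" x = rmem s4 "MIS" x by rewrite ag5.2.
have prdE x : nmem (run retrieve s4) "pred" x = nmem s4 "pred" x by rewrite ag5.1.
split; first by rewrite misE.
  by move=> j c jn cA; apply: table_entry_ext (done4 j c jn cA) => // *.
exists ws; split=> //; first by apply: optimum_ext opt => a _.
by move=> t tn; rewrite prdE follow.
Qed.

End Specification.

(** * Correctness of the recurrence *)

Lemma sum_ord_pred l (F : nat -> nat) :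
  0 < l -> \sum_(a < l) F a = F 0 + \sum_(a < l.-1) F a.+1.
Proof. by case: l => // l _; rewrite big_ord_recl. Qed.

(** As a sum, the count lets the column be split off from the row and the single differing
    coordinate be isolated by [bigD1]. *)
Lemma share_losE (T : eqType) l (p q : l.-tuple T) :
  share_los p q = (\sum_(a < l) (tnth p a != tnth q a) == 1).
Proof.
rewrite /share_los cardsE -sum1_card big_mkcond /=.
by congr (_ == 1); apply: eq_bigr => a _; rewrite inE; case: (_ != _).
Qed.

Lemma last_columnE (R : numDomainType) d k l (W : arr R d k l) i (c : 'I_l) :
  c = l.-1 :> nat -> last_column W i = W (i, c).
Proof.
rewrite /last_column => cE; case: insubP => [c' _ c'E|]; last by rewrite -cE ltn_ord.
by congr (W (i, _)); apply: val_inj; rewrite /= c'E cE.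
Qed.

Lemma location_inj d k (j j' : int) (i i' : row_index d k) :
  location j i = location j' i' -> j = j' /\ i = i'.
Proof.
case=> -> ii; split=> //; apply: val_inj; apply: (inj_map _ ii) => x y [xy].
exact: val_inj.
Qed.

(** The first coordinate becomes the column and the others the row; the bound [k] on the sides [x]
    makes the latter an index of the array. *)
Lemma cube_location d k n (x : d.-1.-tuple nat) (p : d.-tuple nat) : 0 < d ->
    (forall a, 1 <= tnth x a <= k) -> in_cube n x p ->
  exists (c : 'I_n) (i : row_index d k), [seq y%:Z | y <- p]%R = location c.+1%:Z%R i.
Proof.
move=> d0 xk pin.
have pa a : a < d -> 1 <= nth 0 p a <= nth 0 (n :: x) a.
  by move=> ad; have := pin (Ordinal ad); rewrite (tnth_nth 0).
have row_ex (a : 'I_d.-1) : exists y : 'I_k, nth 0 p a.+1 = y.+1.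
  have ad : a.+1 < d by have := ltn_ord a; lia.
  have /andP[p1 px] := pa _ ad.
  have := xk a; rewrite (tnth_nth 0) => /andP[_ xak].
  have yk : (nth 0 p a.+1).-1 < k by rewrite /= in px; lia.
  by exists (Ordinal yk); rewrite /= prednK.
have [h hE] := fin_all_exists row_ex.
have /andP[p0 pn] := pa 0 d0.
have cn : (nth 0 p 0).-1 < n by rewrite /= in pn; lia.
have [i iE] : exists i : row_index d k, forall a, tnth i a = h a.
  by exists (mktuple h) => a; rewrite tnth_mktuple.
exists (Ordinal cn), i.
apply: (@eq_from_nth _ 0%R) => [|b].
  by rewrite /= !size_map !size_tuple prednK.
rewrite size_map size_tuple => bd.
rewrite (nth_map 0) ?size_tuple //; case: b bd => [|b] bd; first by rewrite /= prednK.
have bd' : b < d.-1 by lia.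
rewrite /= (hE (Ordinal bd')) (nth_map (h (Ordinal bd'))) ?size_tuple //.
by rewrite -(tnth_nth _ _ (Ordinal bd')) iE.
Qed.

Section Correctness.
Local Open Scope ring_scope.
Variables (R : realDomainType) (d k n omega : nat).
Hypotheses (d_gt0 : (0 < d)%N) (n_gt0 : (0 < n)%N) (omega_gt0 : (0 < omega)%N).
Variables (V : finType) (e : rel V) (w : V -> R) (f : V -> d.-tuple nat).
Hypotheses (w_gt0 : forall v, 0 < w v) (f_inj : injective f).
Hypothesis eE :
  forall u v, e u v = share_los (f u) (f v) && (manhattan (f u) (f v) < omega)%N.
(** Both count from 0: vertex [v] lies in column [(col v).+1] of the network. *)
Variables (col : V -> 'I_n) (row : V -> row_index d k).
Hypothesis locE : forall v, [seq x%:Z | x <- f v] = location (col v).+1%:Z (row v).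

Local Notation G := (@network_array R d k V w f).

(** * Vertices and edges in terms of rows and columns *)

Lemma place_inj u v : row u = row v -> col u = col v -> u = v.
Proof.
move=> ruv cuv; apply: f_inj; apply: val_inj.
apply: (@inj_map _ _ (fun x : nat => x%:Z)); first by move=> x y [].
by rewrite !locE ruv cuv.
Qed.

Lemma network_array_vertex v : G (row v) (col v).+1%:Z = w v.
Proof.
rewrite /network_array; case: pickP => [u /eqP|/(_ v)]; last by rewrite locE eqxx.
rewrite locE => /location_inj[[/val_inj cE] rE].
by rewrite (place_inj rE cE).
Qed.

Lemma network_array_neq0 i j : reflect
  (exists2 v, row v = i & (col v).+1%:Z = j) (G i j != 0).
Proof.
apply: (iffP idP) => [|[v <- <-]]; last by rewrite network_array_vertex gt_eqF.
rewrite /network_array; case: pickP => [u /eqP|_]; last by rewrite eqxx.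
by rewrite locE => /location_inj[cE rE] _; exists u.
Qed.

(* [selected S i y] says that S has a vertex in row i and in column
   y + 1 - omega, which is column c of the window at j when y = j + c. *)
Definition selected (S : {set V}) (i : row_index d k) (y : nat) : bool :=
  [exists v, [&& v \in S, row v == i & (col v + omega == y)%N]].

Lemma selectedP (S : {set V}) i y : reflect
  (exists v, [/\ v \in S, row v = i & (col v + omega)%N = y]) (selected S i y).
Proof.
apply: (iffP existsP) => -[v] => [/and3P[vS /eqP ri /eqP cy]|[vS ri cy]]; exists v => //.
by rewrite vS ri cy !eqxx.
Qed.

Lemma window_neq0 j i (c : 'I_omega) :
  (window omega G j (i, c) != 0) = selected setT i (j + c).
Proof.
rewrite ffunE /=; apply/network_array_neq0/selectedP.
  by case=> v ri cE; exists v; split; rewrite ?inE //; lia.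
by case=> v [_ ri cE]; exists v => //; lia.
Qed.

(** Between 0/1 arrays the order is inclusion of supports, and the support of a window of [G]
    consists of the places of vertices, as weights are positive. *)
Lemma feasible_inP j (W : arr R d k omega) :
  feasible_in G j W <->
  feasible W /\ forall i c, W (i, c) != 0 -> selected setT i (j + c).
Proof.
split=> -[Wf leW]; split=> //.
  move=> i c Wic; rewrite -window_neq0.
  have := leW (i, c); rewrite ffunE; case: (_ != 0) => //.
  by case: Wf => /(_ (i, c)) [W0|->] _ _; rewrite ?W0 ?eqxx // ler10 in Wic *.
move=> [i c]; rewrite ffunE; case: Wf => W01 _ _.
have [->|W1] := W01 (i, c); first by case: (_ != 0); rewrite ?ler01.
by rewrite window_neq0 leW ?W1 ?oner_eq0.
Qed.

Lemma edgeE u v : e u v =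
  ((col u != col v) + \sum_a (tnth (row u) a != tnth (row v) a) == 1)%N &&
  (`|col u - col v| + \sum_a `|tnth (row u) a - tnth (row v) a| < omega)%N.
Proof.
have f0 x : nth 0%N (f x) 0 = (col x).+1.
  apply/eqP; rewrite -eqz_nat -(nth_map 0%N 0 (fun y : nat => y%:Z)) ?size_tuple //.
  by rewrite locE.
have fS x (a : 'I_d.-1) : nth 0%N (f x) a.+1 = (tnth (row x) a).+1.
  have ad : (a.+1 < d)%N by have := ltn_ord a; lia.
  apply/eqP; rewrite -eqz_nat -(nth_map 0%N 0 (fun y : nat => y%:Z)) ?size_tuple //.
  rewrite locE /= (nth_map (tnth (row x) a)) ?size_tuple //.
  by rewrite -tnth_nth.
rewrite eE share_losE /manhattan.
have -> : (\sum_(a < d) (tnth (f u) a != tnth (f v) a) =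
    (col u != col v) + \sum_a (tnth (row u) a != tnth (row v) a))%N.
  pose F a : nat := nth 0%N (f u) a != nth 0%N (f v) a.
  rewrite (eq_bigr (fun a : 'I_d => F a)) => [|a _]; last by rewrite !(tnth_nth 0%N).
  rewrite sum_ord_pred // /F.
  rewrite !f0 eqSS; congr addn; apply: eq_bigr => a _.
  by rewrite !fS eqSS.
have -> // : (\sum_(a < d) `|tnth (f u) a - tnth (f v) a| =
    `|col u - col v| + \sum_a `|tnth (row u) a - tnth (row v) a|)%N.
pose F a := `|nth 0%N (f u) a - nth 0%N (f v) a|%N.
rewrite (eq_bigr (fun a : 'I_d => F a)) => [|a _]; last by rewrite !(tnth_nth 0%N).
rewrite sum_ord_pred // /F.
rewrite !f0; congr addn; first by lia.
by apply: eq_bigr => a _; rewrite !fS; lia.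
Qed.

Lemma sum_tnth_neq (i i' : row_index d k) a :
    share_los i i' -> tnth i a != tnth i' a ->
  (\sum_b `|tnth i b - tnth i' b| = `|tnth i a - tnth i' a|)%N.
Proof.
rewrite share_losE (bigD1 a) //= => /eqP + ia; rewrite ia => -[].
move/eqP; rewrite sum_nat_eq0 => /forallP same.
rewrite (bigD1 a) //= big1 ?addn0 // => b ba.
have := same b; rewrite ba /= eqb0 negbK => /eqP ->.
by rewrite subrr.
Qed.

Lemma share_los_neq (i i' : row_index d k) :
  share_los i i' -> exists a, tnth i a != tnth i' a.
Proof.
move/eqP => card1.
have /card_gt0P[a] : (0 < #|[set a | tnth i a != tnth i' a]|)%N by rewrite card1.
by rewrite inE => ia; exists a.
Qed.

Lemma edge_same_row u v : row u = row v -> u != v ->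
  e u v = (`|col u - col v| < omega)%N.
Proof.
move=> ruv uv; rewrite edgeE ruv !big1 ?addn0 => [|a _|a _]; rewrite ?eqxx ?subrr //.
by have -> : col u != col v by apply: contraNN uv => /eqP/(place_inj ruv) ->.
Qed.

Lemma edge_same_col u v : col u = col v -> e u v =
  share_los (row u) (row v) && (\sum_a `|tnth (row u) a - tnth (row v) a| < omega)%N.
Proof. by move=> cuv; rewrite edgeE cuv eqxx subrr /= share_losE. Qed.

(** A line of sight changes one coordinate, here the column. So each edge lies within a column or
    within a row, matching the two separation clauses of [feasible]. *)
Lemma edge_row u v : e u v -> col u != col v -> row u = row v.
Proof.
rewrite edgeE => /andP[+ _] => /eqP + cuv; rewrite cuv => -[].
move/eqP; rewrite sum_nat_eq0 => /forallP same; apply: eq_from_tnth => a.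
by have := same a; rewrite /= eqb0 negbK => /eqP.
Qed.

(** * Windows of a vertex set *)

Definition set_window (S : {set V}) (j : nat) : arr R d k omega :=
  [ffun p : row_index d k * 'I_omega => (selected S p.1 (j + p.2))%:R].

Lemma set_window_neq0 S j i c :
  (set_window S j (i, c) != 0) = selected S i (j + c).
Proof. by rewrite ffunE pnatr_eq0 eqb0 negbK. Qed.

Lemma set_window_feasible S j : independent e S -> feasible_in G j (set_window S j).
Proof.
move=> Sind; apply/feasible_inP; split; last first.
  move=> i c; rewrite set_window_neq0 => /selectedP[v [_ ri cE]].
  by apply/selectedP; exists v; rewrite inE.
split.
- by move=> p; rewrite ffunE; case: selected; [right|left].
- move=> i c c' cc'; rewrite !set_window_neq0.
  move=> /selectedP[u [uS ru cu]] /selectedP[v [vS rv cv]].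
  rewrite leqNgt; apply/negP => lt_cc'; have /negP := Sind _ _ uS vS; apply.
  rewrite edge_same_row ?ru ?rv //; first by lia.
  by apply: contraNneq cc' => uv; apply/eqP/val_inj => /=; move: cu cv; rewrite uv; lia.
- move=> i i' c ii'; rewrite !set_window_neq0.
  move=> /selectedP[u [uS ru cu]] /selectedP[v [vS rv cv]].
  have cuv : col u = col v by apply: val_inj => /=; lia.
  have [sh|] := boolP (share_los i i'); [right=> a ia|by left].
  rewrite leqNgt; apply/negP => lt_ii'; have /negP := Sind _ _ uS vS; apply.
  by rewrite edge_same_col // ru rv sh (sum_tnth_neq sh ia).
Qed.

Lemma set_window_consistent S j : (0 < j)%N ->
  consistent (set_window S j.-1) (set_window S j).
Proof.
move=> j0 i c c' cc'; rewrite !ffunE /=; congr (selected _ _ _)%:R; lia.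
Qed.

(** The window at 0 ends in column 0, while vertices occupy columns from 1 on. [feasible_in0] holds
    for the same reason. *)
Lemma set_window0 S : set_window S 0 = zero_arr R d k omega.
Proof.
apply/ffunP => -[i c]; rewrite !ffunE /=; case: selectedP => // -[v [_ _ cE]].
by have := ltn_ord c; lia.
Qed.

Lemma feasible_in0 (W : arr R d k omega) : feasible_in G 0 W -> W = zero_arr R d k omega.
Proof.
case/feasible_inP => _ Wsel; apply/ffunP => -[i c]; rewrite [RHS]ffunE; apply/eqP.
apply: contraT => /Wsel/selectedP[v [_ _ cE]].
by have := ltn_ord c; lia.
Qed.

Let last : 'I_omega := Ordinal (etrans (ltn_predL omega) omega_gt0 : (omega.-1 < omega)%N).

Definition column_weight (S : {set V}) (j : nat) : R :=
  \sum_(v in S | col v == j.-1 :> nat) w v.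

Lemma column_weightE S j : (0 < j)%N ->
  \sum_i (selected S i (j + omega.-1))%:R * G i j%:Z = column_weight S j.
Proof.
move=> j0; rewrite /column_weight (partition_big row xpredT) //=.
apply: eq_bigr => i _; case: selectedP => [[v [vS ri cv]]|Nsel].
  rewrite mul1r -ri (big_pred1 v) => [|u].
    by rewrite -network_array_vertex; congr (G _ _); lia.
  apply/andP/eqP => [[/andP[_ /eqP cu] /eqP ru]|->].
    by apply: place_inj => //; apply: val_inj => /=; lia.
  by split=> //; rewrite vS /=; apply/eqP; lia.
rewrite mul0r big1 // => v /andP[/andP[vS /eqP cv] /eqP ri].
by case: Nsel; exists v; split=> //; lia.
Qed.

Lemma sum_column_weight S : \sum_(1 <= j < n.+1) column_weight S j = \sum_(v in S) w v.
Proof.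
rewrite big_add1 /= big_mkord (partition_big col xpredT) //=.
Qed.

Lemma last_column_set_window S j i :
  last_column (set_window S j) i = (selected S i (j + omega.-1))%:R.
Proof. by rewrite (@last_columnE _ _ _ _ _ _ last) // ffunE. Qed.

(** * Chains of windows in a run of the recurrence *)

Section Run.
Variable MIS : nat -> arr R d k omega -> R.
Variable pred : nat -> arr R d k omega -> arr R d k omega.
Hypotheses (MISi : initialisation n G MIS) (MISr : recurrence n G MIS pred).

(** The windows of [T] form one of the chains over which the recurrence maximizes: at each step the
    window of [T] competes with the chosen predecessor. *)
Lemma MIS_ge T j : independent e T -> (j <= n)%N ->
  \sum_(1 <= l < j.+1) column_weight T l <= MIS j (set_window T j).
Proof.
move=> Tind; elim: j => [|j IH] jn.
  by rewrite big_geq // set_window0; case: MISi => ->.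
have jn' : (1 <= j.+1 <= n)%N by [].
have [_ _ maxp ->] := MISr jn' (set_window_feasible j.+1 Tind).
rewrite big_nat_recr //= addrC lerD //.
  by rewrite -column_weightE //; under [leRHS]eq_bigr do rewrite last_column_set_window.
apply: le_trans (IH (ltnW jn)) (maxp _ _ _); first exact: set_window_feasible.
exact: (@set_window_consistent T j.+1).
Qed.

Variable Ws : nat -> arr R d k omega.
Hypotheses (Wsn : feasible_in G n (Ws n)).
Hypothesis Wsp : forall j, (2 <= j <= n)%N -> Ws j.-1 = pred j (Ws j).

Lemma Ws_feasible j : (1 <= j <= n)%N -> feasible_in G j (Ws j).
Proof.
have : forall t, (t < n)%N -> feasible_in G (n - t) (Ws (n - t)).
  elim=> [|t IH] tn; first by rewrite subn0.
  have jn : (1 <= n - t <= n)%N by lia.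
  have [+ _ _ _] := MISr jn (IH (ltnW tn)).
  by rewrite -Wsp ?subnS //; lia.
move=> Wsf jn; have -> : j = (n - (n - j))%N by lia.
by apply: Wsf; lia.
Qed.

Lemma Ws_consistent j : (2 <= j <= n)%N -> consistent (Ws j.-1) (Ws j).
Proof.
move=> jn; have jn' : (1 <= j <= n)%N by lia.
by have [_ + _ _] := MISr jn' (Ws_feasible jn'); rewrite -Wsp.
Qed.

(** Each step of consistency moves the entry one column to the right in the preceding window, until
    it reaches the last column. Thus the last columns, which form the output, determine the
    windows. *)
Lemma Ws_shift i j t (c : 'I_omega) : (t < j)%N -> (j <= n)%N ->
  (c + t)%N = omega.-1 -> Ws j (i, c) = last_column (Ws (j - t)%N) i.
Proof.
elim: t j c => [|t IH] j c tj jn ct.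
  by rewrite subn0 (@last_columnE _ _ _ _ _ _ c) // -ct addn0.
have c1 : (c.+1 < omega)%N by lia.
have jn2 : (2 <= j <= n)%N by lia.
rewrite -(@Ws_consistent j jn2 i c (Ordinal c1)) // (IH j.-1) /=; try lia.
by congr (last_column (Ws _) i); lia.
Qed.

Let S := [set v | last_column (Ws (col v).+1) (row v) != 0].

(** A non-zero entry lies at a vertex, by feasibility in [G], and the definition of [S] then selects
    that vertex. *)
Lemma last_column_Ws j i : (1 <= j <= n)%N ->
  last_column (Ws j) i = (selected S i (j + omega.-1))%:R.
Proof.
move=> jn; have [] := (feasible_inP _ _).1 (Ws_feasible jn).
move=> [W01 _ _] Wsel; have lastE := @last_columnE R d k omega (Ws j) i last erefl.
case: (selectedP S) => [[v []]|Nsel].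
  rewrite inE => + ri cv; have -> : (col v).+1 = j by lia.
  by rewrite ri lastE; case: (W01 (i, last)) => ->; rewrite ?eqxx.
apply/eqP; apply: contraT; rewrite lastE => W0.
have /selectedP[v [_ ri cv]] := Wsel _ _ W0; case: Nsel; exists v; split=> //.
rewrite inE ri; have -> : (col v).+1 = j by rewrite /= in cv; lia.
by rewrite lastE.
Qed.

(** The counterpart of [MIS_ge]: along the chain that follows [pred], each step adds exactly the
    weight of [S] in one column, so the computed value is attained by [S]. *)
Lemma MIS_Ws j : (1 <= j <= n)%N ->
  MIS j (Ws j) = \sum_(1 <= l < j.+1) column_weight S l.
Proof.
(* Stated with [pred] instead of [Ws i.-1], since [Wsp] ties the two together only from [i = 2]
   on. *)
have stepE i : (1 <= i <= n)%N -> let W' := pred i (Ws i) in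
    MIS i (Ws i) = column_weight S i + MIS i.-1 W'.
  move=> jn; have [_ _ _ ->] := MISr jn (Ws_feasible jn); congr (_ + _).
  by rewrite -column_weightE; [apply: eq_bigr => r _; rewrite last_column_Ws|lia].
elim: j => [//|[|j] IH] jn; rewrite stepE // big_nat_recr //= addrC; congr (_ + _).
  (* The predecessor at column 0 is the zero window, the one cell of row 0 whose value
     [initialisation] fixes. *)
  have [W0 _ _ _] := MISr jn (Ws_feasible jn).
  by rewrite big_geq // (feasible_in0 W0); case: MISi.
by rewrite -IH -?Wsp //; lia.
Qed.

(** Take the window that ends at the right end of an edge. If both ends share a column, its column
    clause excludes the edge. Otherwise they share a row and are less than [omega] columns apart, so
    by [Ws_shift] the left end also has its entry in this window, and the row clause applies. *)
Lemma S_independent : independent e S.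
Proof.
suff half u v : u \in S -> v \in S -> (col u <= col v)%N -> ~~ e u v.
  move=> u v uS vS; case: (leqP (col u) (col v)) => [|/ltnW] le_c; first exact: half.
  have := half _ _ vS uS le_c; rewrite !edgeE !(eq_sym (col v)) distnC.
  congr (~~ (_ && _)); congr (_ + _ == _)%N || congr (_ + _ < _)%N;
    by apply: eq_bigr => a _; rewrite 1?eq_sym 1?distnC.
move=> uS vS le_c; apply/negP => euv.
have jn : (1 <= (col v).+1 <= n)%N by rewrite /= ltn_ord.
have := Ws_feasible jn; set W := Ws (col v).+1 => -[[_ Wrow Wcol] _].
move: (uS) (vS); rewrite !inE => Wu; rewrite (@last_columnE _ _ _ _ _ _ last) // => Wv.
have [cuv|cuv] := eqVneq (col u) (col v).
  move: euv; rewrite edge_same_col // => /andP[sh lt_o].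
  have [a ia] := share_los_neq sh.
  have ruv : row u != row v by apply: contraNneq ia => ->.
  rewrite cuv (@last_columnE _ _ _ _ _ _ last) // in Wu.
  have [|/(_ a ia)] := Wcol _ _ _ ruv Wu Wv; first by rewrite sh.
  by rewrite -(sum_tnth_neq sh ia) leqNgt lt_o.
have ruv := edge_row euv cuv.
have uv : u != v by apply: contraNneq cuv => ->.
rewrite edge_same_row // in euv.
have lt_c : (omega.-1 - (col v - col u) < omega)%N by lia.
have Wu' : W (row v, Ordinal lt_c) != 0.
  rewrite (@Ws_shift _ _ (col v - col u)) -?ruv /=; try lia.
  by have -> : ((col v).+1 - (col v - col u) = (col u).+1)%N by lia.
have cl : Ordinal lt_c != last.
  by apply: contraNneq cuv => /(congr1 val) /= E; apply/eqP/val_inj => /=; lia.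
have := Wrow _ _ _ cl Wu' Wv; rewrite /=; lia.
Qed.

End Run.

Lemma dp_run_maximum MIS pred (I : arr R d k n) : dp_run (omega := omega) G MIS pred I ->
  exists2 S : {set V}, marks f I S & maximum_independent e w S.
Proof.
case=> MISi MISr [Ws [Wsn Wsmax Wsp IE]].
pose S := [set v | last_column (Ws (col v).+1) (row v) != 0].
exists S.
  move=> i c; rewrite IE; split=> [Wic|[v vS]]; last first.
    by rewrite locE => /location_inj[[cE] <-]; move: vS; rewrite inE -(val_inj cE).
  have cn : (1 <= c.+1 <= n)%N by rewrite /= ltn_ord.
  move: Wic; rewrite (last_column_Ws MISr Wsn Wsp) // pnatr_eq0 eqb0 negbK.
  case/selectedP => v [vS ri cE]; exists v => //.
  by rewrite locE ri; congr location; lia.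
split=> [|T Tind]; first exact: (S_independent MISr Wsn Wsp).
rewrite -!sum_column_weight -(MIS_Ws MISi MISr Wsn Wsp) ?n_gt0 ?leqnn //.
apply: le_trans (MIS_ge MISi MISr Tind (leqnn n)) _.
by apply: Wsmax; exact: set_window_feasible.
Qed.

End Correctness.

(** * Codes and arrays *)

Section RowRank.
Variables (d k : nat).
Hypothesis (k_gt0 : 0 < k).
Local Notation N := (k ^ d.-1).

Definition row_of (r : nat) : row_index d k :=
  [tuple Ordinal (ltn_pmod (r %/ k ^ a) k_gt0) | a < d.-1].

(** The digit lemmas expect a function on [nat]; [nth] extends the entries of the tuple by 0. *)
Lemma row_rankE (i : row_index d k) :
  row_rank i = \sum_(a < d.-1) nth 0 [seq val x | x <- i] a * k ^ a.
Proof.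
apply: eq_bigr => a _; congr (_ * _).
by rewrite (nth_map (tnth i a)) ?size_tuple // -tnth_nth.
Qed.

Lemma row_entry_lt (i : row_index d k) a : nth 0 [seq val x | x <- i] a < k.
Proof.
case: (ltnP a (size i)) => [lt_a|le_a]; last by rewrite nth_default ?size_map.
have ad : a < d.-1 by rewrite size_tuple in lt_a.
by rewrite (nth_map (tnth i (Ordinal ad))) // ltn_ord.
Qed.

Lemma row_rank_lt (i : row_index d k) : row_rank i < N.
Proof. by rewrite row_rankE; apply: digits_lt => a _; exact: row_entry_lt. Qed.

Lemma coordinate_row_rank (i : row_index d k) (a : 'I_d.-1) :
  coordinate k (row_rank i) a = tnth i a.
Proof.
rewrite /coordinate row_rankE (digits_nth k_gt0) // => [|b _]; last exact: row_entry_lt.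
by rewrite (nth_map (tnth i a)) ?size_tuple // -tnth_nth.
Qed.

Lemma row_rankK : cancel (@row_rank d k) row_of.
Proof.
move=> i; apply: eq_from_tnth => a; apply: val_inj.
by rewrite tnth_mktuple /= -coordinate_row_rank.
Qed.

Lemma row_ofK r : r < N -> row_rank (row_of r) = r.
Proof.
move=> rN; rewrite -[RHS](modn_small rN) -(sum_digits k_gt0).
by apply: eq_bigr => a _; rewrite tnth_mktuple.
Qed.

Lemma sum_rows (T : nmodType) (F : row_index d k -> T) :
  (\sum_i F i = \sum_(r < N) F (row_of r))%R.
Proof.
rewrite (reindex_onto (fun r : 'I_N => row_of r) (fun i => Ordinal (row_rank_lt i))) /=.
  by apply: eq_bigl => r; apply/eqP/val_inj; rewrite /= row_ofK.
by move=> i _; rewrite /= row_rankK.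
Qed.

Lemma differ_row_rank (i i' : row_index d k) :
  (differ k (row_rank i) (row_rank i') d.-1 == 1) = share_los i i'.
Proof.
by rewrite share_losE; congr (_ == 1); apply: eq_bigr => a _; rewrite !coordinate_row_rank.
Qed.

(** [dist] changes only at differing places, so the value set at the only one, [a], survives to the
    end. *)
Lemma dist_unique r q m a : a < m -> coordinate k r a != coordinate k q a ->
    (forall b, b < m -> b != a -> coordinate k r b = coordinate k q b) ->
  dist k r q m = `|coordinate k r a - coordinate k q a|.
Proof.
move=> am ra; elim: m am => // m IH am same /=.
have [E|ma] := eqVneq m a; first by rewrite E ra; lia.
by rewrite same // eqxx /= IH // => [|b bm]; [lia|apply: same; exact: ltnW].
Qed.

Lemma dist_row_rank (i i' : row_index d k) a :
    share_los i i' -> tnth i a != tnth i' a ->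
  dist k (row_rank i) (row_rank i') d.-1 = `|tnth i a - tnth i' a|.
Proof.
rewrite share_losE (bigD1 a) //= => /eqP + ia; rewrite ia => -[].
move/eqP; rewrite sum_nat_eq0 => /forallP same.
rewrite (@dist_unique _ _ _ a) ?coordinate_row_rank // => b bd ba.
have := same (Ordinal bd); rewrite -(inj_eq val_inj) /= ba /= eqb0 negbK => /eqP E.
by rewrite (coordinate_row_rank i (Ordinal bd)) E -coordinate_row_rank.
Qed.

End RowRank.

(** * Codes of feasible arrays *)

Section Codes.
Variables (R : realDomainType) (d k omega : nat).
Hypotheses (k_gt0 : 0 < k) (omega_gt0 : 0 < omega).
Local Notation N := (k ^ d.-1).
Local Notation B := omega.+1.
Local Notation A := (B ^ N).
Local Notation dig := (digit_at omega).
Local Notation decode := (@decode R d k omega).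
Implicit Types (W : arr R d k omega) (i : row_index d k).

(** The inner sum of [code]. For a feasible array it has at most one term, because two of the
    [omega] columns are always less than [omega] apart. *)
Definition row_digit W i : nat := \sum_(c < omega | W (i, c) != 0%R) c.+1.

Lemma row_digitE W i c : feasible W -> W (i, c) != 0%R -> row_digit W i = c.+1.
Proof.
case=> _ Wrow _ Wic; rewrite /row_digit (big_pred1 c) // => c'.
apply/idP/eqP => [Wic'|->//]; apply/eqP; apply: contraT => cc'.
by have := Wrow _ _ _ cc' Wic' Wic; have := ltn_ord c; have := ltn_ord c'; lia.
Qed.

Lemma row_digit0 W i : (forall c, W (i, c) = 0%R) -> row_digit W i = 0.
Proof. by move=> W0; rewrite /row_digit big_pred0 // => c; rewrite W0 eqxx. Qed.

Lemma row_digit_lt W i : feasible W -> row_digit W i < B.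
Proof.
move=> Wf; case: (pickP (fun c => W (i, c) != 0%R)) => [c Wic|W0].
  by rewrite (row_digitE Wf Wic) ltnS.
by rewrite row_digit0 // => c; apply/eqP; have := W0 c; case: eqP.
Qed.

Lemma row_digit_eq W i (c : 'I_omega) :
  feasible W -> (row_digit W i == c.+1) = (W (i, c) != 0%R).
Proof.
move=> Wf; apply/eqP/idP => [E|]; last exact: row_digitE.
case: (pickP (fun c => W (i, c) != 0%R)) => [c' Wic'|W0].
  by move: E; rewrite (row_digitE Wf Wic') => -[/val_inj <-].
by move: E; rewrite row_digit0 // => a; apply/eqP; have := W0 a; case: eqP.
Qed.

Lemma codeE W : code W = \sum_(r < N) row_digit W (row_of d k_gt0 r) * B ^ r.
Proof.
rewrite /code (sum_rows k_gt0 (fun i => row_digit W i * B ^ row_rank i)).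
by apply: eq_bigr => r _; rewrite row_ofK.
Qed.

Lemma code_lt W : feasible W -> code W < A.
Proof.
move=> Wf; rewrite codeE.
by apply: (@digits_lt _ (fun r => row_digit W (row_of d k_gt0 r))) => r _; exact: row_digit_lt.
Qed.

Lemma dig_code W i : feasible W -> dig (code W) (row_rank i) = row_digit W i.
Proof.
move=> Wf; rewrite codeE /digit_at (digits_nth (ltn0Sn omega)
  (f := fun r => row_digit W (row_of d k_gt0 r))) ?row_rank_lt ?row_rankK // => r _.
exact: row_digit_lt.
Qed.

Lemma decodeE a i (c : 'I_omega) :
  decode a (i, c) = (dig a (row_rank i) == c.+1)%:R%R.
Proof. by rewrite ffunE. Qed.

Lemma decode_neq0 a i (c : 'I_omega) :
  (decode a (i, c) != 0%R) = (dig a (row_rank i) == c.+1).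
Proof. by rewrite decodeE pnatr_eq0 eqb0 negbK. Qed.

Lemma codeK W : feasible W -> decode (code W) = W.
Proof.
move=> Wf; apply/ffunP => -[i c]; rewrite decodeE dig_code // row_digit_eq //.
by case: Wf => /(_ (i, c))[] -> _ _; rewrite ?eqxx ?oner_eq0.
Qed.

Lemma row_digit_decode a i : row_digit (decode a) i = dig a (row_rank i).
Proof.
rewrite /row_digit; under eq_bigl do rewrite decode_neq0.
case E: (dig a (row_rank i)) => [|x]; first by rewrite big_pred0.
have xo : x < omega by rewrite -ltnS -E ltn_mod.
by rewrite (big_pred1 (Ordinal xo)) // => c; rewrite eqSS eq_sym -(inj_eq val_inj).
Qed.

Lemma decodeK a : a < A -> code (decode a) = a.
Proof.
move=> aA; rewrite codeE -[RHS](modn_small aA) -(sum_digits (ltn0Sn omega)).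
by apply: eq_bigr => r _; rewrite row_digit_decode row_ofK.
Qed.

Lemma feasible_decode a : feasible (decode a) <-> feasible_code d k omega a.
Proof.
split=> [[_ _ col] | /allP aF].
  apply/allP => r; rewrite mem_iota add0n => /= rN.
  apply/allP => q; rewrite mem_iota add0n => /= qN.
  rewrite -(row_ofK k_gt0 rN) -(row_ofK k_gt0 qN).
  move: (row_of _ _ r) (row_of _ _ q) => i i'; rewrite /conflict differ_row_rank //.
  apply/negP => /and4P[]; case E: (dig a (row_rank i)) => [//|x] _ /eqP E' sh.
  have [b ib] := share_los_neq sh.
  have xo : x < omega by rewrite -ltnS -E ltn_mod.
  have ii' : i != i' by apply: contraNneq ib => ->.
  have := col i i' (Ordinal xo) ii'; rewrite !decode_neq0 E -E' eqxx => /(_ isT isT).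
  case=> [|/(_ b ib)]; first by rewrite sh.
  by rewrite (dist_row_rank k_gt0 sh ib) leqNgt => /negbTE ->.
split=> [[i c]|i c c' cc'|i i' c ii'].
- by rewrite decodeE; case: eqP; [right|left].
- by rewrite !decode_neq0 => /eqP -> /eqP [/val_inj E]; rewrite E eqxx in cc'.
rewrite !decode_neq0 => /eqP ac /eqP ac'.
have [sh|] := boolP (share_los i i'); [right=> b ib|by left].
have := aF (row_rank i); rewrite mem_iota add0n row_rank_lt // => /(_ isT).
move=> /allP/(_ (row_rank i')); rewrite mem_iota add0n row_rank_lt // => /(_ isT).
by rewrite /conflict ac ac' eqxx differ_row_rank // sh (dist_row_rank k_gt0 sh ib) /= -leqNgt.
Qed.

(** Consistency makes [c] determine the digits of [a] that are at least 2. A row without such a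
    digit has digit 0 or 1, which is exactly what a bit of the mask supplies. *)
Lemma extensionP c a : a < A ->
  (exists2 m, m < 2 ^ N & a = extension d k omega c m) <->
  consistent (decode a) (decode c).
Proof.
move=> aA; split=> [[m _ ->] i x y yx|cons].
  rewrite !decodeE dig_extension ?row_rank_lt // /extension_digit yx.
  case: ifP => [_|]; first by rewrite eqSS.
  have xo : x.+1 < omega by rewrite -yx.
  case: (dig c _ =P x.+1) => [->|_ _]; first by rewrite xo.
  by case: (_ %% 2) (ltn_pmod (m %/ 2 ^ row_rank i) (isT : 0 < 2)) => [|[|]].
(* The mask marks the rows whose entry in the predecessor is in the first column. *)
pose m := \sum_(r < N) (dig a r == 1) * 2 ^ r.
exists m; first by apply: (@digits_lt 2 (fun r => dig a r == 1)) => r _; case: (_ == _).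
rewrite -[LHS](modn_small aA) -(sum_digits (ltn0Sn omega)).
apply: eq_bigr => -[r rN] _; congr (_ * _); rewrite -/(dig a r) /= /extension_digit.
rewrite /m (digits_nth (isT : 0 < 2) (f := fun r => dig a r == 1)) //; last first.
  by move=> q _; case: (_ == _).
have consr x : 0 < x < omega -> (dig a r == x.+1) = (dig c r == x).
  case: x => // x /= xo; have x1o := ltnW xo.
  have := cons (row_of d k_gt0 r) (Ordinal x1o) (Ordinal xo) erefl.
  rewrite !decodeE row_ofK //= => /eqP.
  by rewrite eqr_nat; case: (dig a r == _); case: (dig c r == _).
case: ifP => [c0|c0]; first by apply/eqP; rewrite consr.
case E: (dig a r) => [//|[//|x]].
have xo : x.+1 < omega by rewrite -ltnS -E ltn_mod.
by have := consr x.+1 xo; rewrite E eqxx => /esym/eqP cx; rewrite cx xo in c0.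
Qed.

End Codes.

(** * From the memory of the machine to arrays *)

Section Refinement.
Local Open Scope ring_scope.
Variables (R : realDomainType) (d k n omega : nat).
Hypotheses (k_gt0 : (0 < k)%N) (n_gt0 : (0 < n)%N) (omega_gt0 : (0 < omega)%N).
Variable G : row_index d k -> int -> R.
Hypothesis G_ge0 : forall i j, 0 <= G i j.
Local Notation N := (k ^ d.-1)%N.
Local Notation A := (omega.+1 ^ N)%N.
Local Notation decode := (@decode R d k omega).
Variable s : state R.
Hypothesis sG : stores_network n omega G s.

(** Taking the memory itself for [g] makes the clause of [inputs] about it an identity; [gE] then
    compares it with the network. *)
Let g (c r : nat) : R := rmem s "G" (c * N + r)%N.

Let gE j x i : (j <= n)%N -> (x < omega)%N ->
  g (j + x) (row_rank i) = G i (j%:Z - omega%:Z + 1 + x%:Z).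
Proof.
by move=> jn xo; rewrite /g; case: sG => _ _ _ _ ->; [congr (G _ _)|]; lia.
Qed.

Lemma stores_inputs : inputs d k n omega g s.
Proof. by case: sG. Qed.

Lemma feasible_in_decode j a : (j <= n)%N ->
  feasible_in G j (decode a) <-> admissible d k omega g j a.
Proof.
move=> jn; rewrite /feasible_in /admissible; split=> [[/feasible_decode -> // le_a]|].
  apply/allP => r; rewrite mem_iota add0n => /= rN; rewrite -(row_ofK k_gt0 rN).
  move: (row_of _ _ r) => i; case E: (digit_at omega a (row_rank i)) => [//|x] /=.
  have xo : (x < omega)%N by rewrite -ltnS -E ltn_mod.
  have := le_a (i, Ordinal xo); rewrite decodeE !ffunE /= E eqxx addnS subn1 gE //.
  (* The array test asks for a non-zero weight, the program for a positive one; they agree by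
     [G_ge0]. *)
  by case: eqP => [_|/eqP]; rewrite ?ler10 // lt_def G_ge0 => ->.
case/andP=> /(@feasible_decode R _ _ _ k_gt0) aF /allP aP; split=> // -[i x].
rewrite decodeE !ffunE /=; case: eqP => [E|_]; last by case: eqP.
have := aP (row_rank i); rewrite mem_iota add0n row_rank_lt // E /= addnS subn1 gE //.
by move=> /(_ isT) G_gt0; rewrite gt_eqF.
Qed.

Lemma feasible_in_code j (W : arr R d k omega) : (j <= n)%N -> feasible_in G j W ->
  admissible d k omega g j (code W).
Proof. by move=> jn Wj; apply/feasible_in_decode => //; rewrite codeK //; case: Wj. Qed.

Lemma last_column_decode a i :
  last_column (decode a) i = (digit_at omega a (row_rank i) == omega)%:R.
Proof.
have lo : (omega.-1 < omega)%N by rewrite prednK.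
by rewrite (@last_columnE _ _ _ _ _ _ (Ordinal lo)) // decodeE /= prednK.
Qed.

Lemma last_weightE j a : (j <= n)%N ->
  last_weight d k omega g j a = \sum_i last_column (decode a) i * G i j%:Z.
Proof.
move=> jn; rewrite (sum_rows k_gt0) /last_weight big_mkcond; apply: eq_bigr => r _.
rewrite last_column_decode row_ofK //; case: eqP => _; last by rewrite mul0r.
rewrite mul1r -{1}(row_ofK k_gt0 (ltn_ord r)) -addnBA // gE //; last by lia.
by congr (G _ _); lia.
Qed.

Lemma candidateP j c a : (j <= n)%N -> candidate d k omega g j c a <->
  [/\ (a < A)%N, feasible_in G j (decode a) & consistent (decode a) (decode c)].
Proof.
move=> jn; split=> [[m mN [aE oka]]|[aA aj ca]].
  have aA : (a < A)%N by rewrite aE extension_lt.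
  split=> //; first exact/feasible_in_decode.
  by apply/extensionP => //; exists m.
have [m mN aE] := (extensionP R k_gt0 omega_gt0 c aA).2 ca.
by exists m => //; split=> //; exact/feasible_in_decode.
Qed.

Lemma dp_program_correct : let s' := run dp_program s in
  dp_run G (@stored_MIS R d k omega s') (@stored_pred R d k omega s')
    (@stored_output R d k n s').
Proof.
have [] := dp_program_run k_gt0 n_gt0 omega_gt0 stores_inputs.
move: (run dp_program s) => s' /= mis0 tab [ws [opt follow out]].
rewrite /dp_run /stored_MIS /stored_pred /table_index; split.
- split.
    have -> : code (zero_arr R d k omega) = 0%N; last by rewrite mul0n.
    by rewrite /code big1 // => i _; rewrite big_pred0 // => c; rewrite ffunE eqxx.
  move=> j W jn Wf WNj; have := tab j (code W) jn (code_lt k_gt0 omega_gt0 Wf).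
  rewrite /table_entry; case: ifP => // okW; case: WNj.
  rewrite -(codeK k_gt0 omega_gt0 Wf); apply/feasible_in_decode => //; by case/andP: jn.
- move=> j W jn Wj /=; have [Wf _] := Wj.
  have jn1 : (j <= n)%N by case/andP: jn.
  have jn2 : (j.-1 <= n)%N by lia.
  have := tab j (code W) jn (code_lt k_gt0 omega_gt0 Wf).
  rewrite /table_entry (feasible_in_code jn1 Wj).
  move=> -[[/candidateP-/(_ jn2) [bA bj bW] bmax] ->].
  rewrite codeK // in bW; rewrite decodeK //.
  split=> // [W'' W''j W''W|]; last by rewrite last_weightE // codeK.
  have [W''f _] := W''j; apply: bmax; apply/candidateP => //.
  by split; rewrite ?codeK // code_lt.
(* [ws] counts the steps back from column [n], [Ws] is indexed by the column itself. *)
pose Ws j := decode (ws (n - j)%N).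
have ws_ok t : (t < n)%N -> (ws t < A)%N /\ admissible d k omega g (n - t) (ws t).
  elim: t => [|t IH] tn; first by rewrite subn0; case: opt.
  have [wA wok] := IH (ltnW tn).
  have jn : (0 < n - t <= n)%N by lia.
  have := tab _ _ jn wA; rewrite /table_entry wok -follow; last by lia.
  case=> -[[m _ [wE ok]] _] _; rewrite subnS; split=> //.
  by rewrite wE extension_lt.
exists Ws; split.
- rewrite /Ws subnn; apply/feasible_in_decode => //.
  by have [_] := ws_ok 0%N n_gt0; rewrite subn0.
- move=> W Wn; have [Wf _] := Wn; have [[wA wn] wmax] := opt.
  rewrite /Ws subnn decodeK //; apply: wmax; split; first exact: code_lt.
  exact: feasible_in_code.
- move=> j jn; have [|wA _] := ws_ok (n - j)%N; first by lia.
  rewrite /Ws decodeK //; have -> : (n - j.-1 = (n - j).+1)%N by lia.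
  by rewrite follow ?subKn //; lia.
move=> i c; rewrite ffunE /Ws last_column_decode /=.
have tn : (n - c.+1 < n)%N by lia.
have := out _ (row_rank i) tn (row_rank_lt k_gt0 i).
have -> : (n - (n - c.+1) - 1 = c)%N by have := ltn_ord c; lia.
by move=> ->.
Qed.

End Refinement.

(** * Running time *)

Lemma all_named X : all (named X) X.
Proof.
suff: forall Y, all (named (Y ++ X)) X by move/(_ [::]).
elim: X => //= x X IH Y; rewrite named_cat /= eqb_refl_string orbT /=.
by rewrite -cat_rcons.
Qed.

Lemma time_le_self (R : numDomainType) (c : stmt) (s : state R) :
  all (fun x => ~~ named (writes c) x) (bound_reads c) -> time c s <= time_bound s c.
Proof. by move=> bc; apply: time_le bc (all_named _) (agree_refl _ _). Qed.

(** * Bounds by multiples with an inferred factor *)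

Section Multiples.
Variable m : nat.
Hypothesis m_gt0 : 0 < m.

Lemma multiple_cst c : c <= c * m.
Proof. by rewrite leq_pmulr. Qed.

Lemma multiple_add K L x y : x <= K * m -> y <= L * m -> x + y <= (K + L) * m.
Proof. by move=> xK yL; rewrite mulnDl leq_add. Qed.

Lemma multiple_succ K x : x <= K * m -> x.+1 <= K.+1 * m.
Proof. by move=> xK; rewrite -addn1 -(addn1 K); apply: multiple_add xK (multiple_cst 1). Qed.

Lemma multiple_loop l K x : 0 < l -> x <= K * m -> l * x <= K * (l * m).
Proof. by move=> l0 xK; rewrite mulnCA leq_mul2l xK orbT. Qed.

End Multiples.

Lemma multiple_pred n m K x : x <= K * m -> (n - 1) * x <= K * (n * m).
Proof. by move=> xK; rewrite mulnCA leq_mul ?leq_subr. Qed.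

(** Serves a loop over codes nested in a loop over columns, where a multiple of [A] is wanted;
    [multiple_alone] serves one outside. In both the cost [x] of an iteration becomes the factor. *)
Lemma multiple_inner A x : A * x <= x * A.
Proof. by rewrite mulnC. Qed.

Lemma multiple_alone n A x : 0 < n -> A * x <= x * (n * A).
Proof. by move=> n0; rewrite mulnC leq_mul2l leq_pmull ?orbT. Qed.

(* Proves [x <= ?K * m].  The evar K is created before n and A are introduced, so
   that [multiple_cst] applies only to subterms in which they do not occur. *)
Ltac multiple := first
  [ apply: multiple_cst; assumption
  | apply: multiple_add; multiple
  | apply: multiple_succ; [assumption|multiple]
  | apply: multiple_inner
  | apply: multiple_alone; assumption
  | apply: multiple_loop; [assumption|multiple]
  | apply: multiple_pred; multiple ].

Section Time.
Import ProgramNotations.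
Local Open Scope string_scope.
Local Open Scope nat_scope.
Variables (d k : nat).
Local Notation N := (k ^ d.-1).

Lemma main_time : exists K, forall (R : realDomainType) n omega g (s : state R),
    0 < n -> env d k n omega g s ->
  time (Seq compute_feasible (Seq initialise (Seq fill_tables retrieve))) s <=
    K * (n * omega.+1 ^ N).
Proof.
eexists => R n omega g s n0 sE; apply: leq_trans (time_le_self _ _) _ => //=.
rewrite (in_d sE) (in_n sE) (env_rows sE) (env_codes sE) (env_masks sE).
have : 0 < omega.+1 ^ N by rewrite expn_gt0.
move: (omega.+1 ^ N) => A A0.
have nA0 : 0 < n * A by rewrite muln_gt0 n0.
multiple.
Qed.

(** Treated apart because [setup] computes [rows] before using it as a loop bound, which
    [time_le_self] forbids. It is cut into pieces none of which writes a bound of its own loops. *)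
Lemma setup_time : exists K, forall (R : realDomainType) n omega g (s : state R),
  inputs d k n omega g s -> time setup s <= K.
Proof.
eexists => R n omega g s sI; have := env_rows (setup_env sI).
rewrite /setup run_seq time_seq; have ag1 := run_agree (Nset "rows" 0 1) s.
have d1 : nmem (run (Nset "rows" 0 1) s) "d" 0 = d by rewrite ag1.1 // (in_d sI).
move: (run _ s) d1 => s1 d1 {ag1}.
rewrite run_seq time_seq => rowsE.
apply: leq_add; first exact: leqnn.
apply: leq_add; apply: leq_trans (time_le_self _ _) _ => //=.
  by rewrite d1.
by rewrite run_nmem // in rowsE; rewrite rowsE.
Qed.

Lemma dp_program_time : exists K, forall (R : realDomainType) n omega g (s : state R),
    0 < n -> inputs d k n omega g s ->
  time dp_program s <= K * (n * omega.+1 ^ N).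
Proof.
have [K1 main] := main_time; have [K2 setup] := setup_time.
exists (K2 + K1) => R n omega g s n0 sI; rewrite /dp_program time_seq.
apply: multiple_add; last exact: main (setup_env sI).
by apply: leq_trans (setup _ _ _ _ _ sI) _; rewrite multiple_cst // muln_gt0 n0 expn_gt0.
Qed.

End Time.

Local Open Scope ring_scope.

Theorem theorem1 (R : realType) (d k : nat) (d_gt0 : (0 < d)%N) (k_gt0 : (0 < k)%N) :
  exists C : R,
    forall (n omega : nat) (V : finType) (e : rel V) (w : V -> R) (f : V -> d.-tuple nat),
      (0 < n)%N -> (0 < omega)%N -> (forall v, 0 < w v) ->
      narrow_los_network k n omega e f ->
      let G := @network_array R d k V w f in
      (forall (MIS : nat -> arr R d k omega -> R)
              (pred : nat -> arr R d k omega -> arr R d k omega) (I : arr R d k n),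
         dp_run G MIS pred I ->
         exists2 S : {set V}, marks f I S & maximum_independent e w S)
      /\
      (forall s : state R,
         stores_network n omega G s ->
         let: (s', time) := exec dp_program s in
         dp_run G (@stored_MIS R d k omega s') (@stored_pred R d k omega s')
           (@stored_output R d k n s')
         /\
         time%:R <= C * (n%:R * (k%:R `^ (d.-1%:R / omega%:R) * omega%:R) ^+ (k ^ d.-1)%N)).
Proof.
have [K timeK] := dp_program_time d k.
(* The factor besides [K] pays for replacing [omega.+1] by [2 * omega] in each of the [k ^ d.-1]
   rows. *)
exists (K * 2 ^ k ^ d.-1)%:R => n omega V e w f n0 o0 w0 [f_inj [x [xk xin]] eE] G.
have [col] := fin_all_exists (fun v => cube_location d_gt0 xk (xin v)).
move=> /fin_all_exists[row locE]; split=> [MIS pred I|s sG].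
  exact: dp_run_maximum locE _ _ _.
have -> : exec dp_program s = (run dp_program s, time dp_program s).
  by rewrite /run /time -surjective_pairing.
split.
  apply: dp_program_correct => // i j.
  by rewrite /G /network_array; case: pickP => // v _; exact: ltW.
apply: (@le_trans _ _ (K * (n * omega.+1 ^ k ^ d.-1))%:R).
  by rewrite ler_nat; apply: timeK (stores_inputs sG).
rewrite !natrM -mulrA ler_wpM2l // mulrCA ler_wpM2l //.
have pow1 : 1 <= k%:R `^ (d.-1%:R / omega%:R) :> R.
  have := @ler_powR R k%:R _ 0 (d.-1%:R / omega%:R) _; rewrite powRr0; apply.
    by rewrite ler1n.
  by rewrite divr_ge0.
rewrite !natrX -exprMn lerXn2r ?nnegrE // ?mulr_ge0 ?powR_ge0 //.
apply: (@le_trans _ _ (2 * omega%:R)); first by rewrite -natrM ler_nat; lia.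
by rewrite ler_wpM2l // ler_peMl.
Qed.
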